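(* Let $X$ be any diffeological space. Then $(\mathcal{P}(X),X)$, with structure maps $\sigma(u)=u(0)$, $\tau(u)=u(1)$ for $u\in\mathcal{P}(X)$ and $\iota(x)=$ the constant path at $x\in X$, is an internal (smooth) h-unital $A_\infty$-category in the category of diffeological spaces.
   Context: **Diffeology.** $\mathbb{N}$ is the set of non-negative integers. Diffeological spaces have plots defined on open subsets of Euclidean spaces $\mathbb{R}^m$, $m\in\mathbb{N}$. Subsets carry the subspace diffeology, products the product diffeology, and $C^\infty(A,B)$ the functional diffeology. A subduction is a smooth surjection whose target carries the push-forward diffeology. For smooth maps $f,g:A\to B$, $f\simeq g$ means that they are smoothly homotopic, i.e. there is a smooth map $H:\mathbb{R}\times A\to B$ with $H(0,\cdot)=f$ and $H(1,\cdot)=g$. **Paths.** Let $\pi_{set}:\mathbb{R}\to\mathbb{R}$, $\pi_{set}(t)=\max\{0,\min\{1,t\}\}$. $\mathcal{P}(X)=\{u\in C^\infty(\mathbb{R},X)\mid u\circ\pi_{set}=u\}$, as a diffeological subspace of $C^\infty(\mathbb{R},X)$. **Associahedra as smooth cubic complexes.** For $n\ge2$ let $K_n=\{(t_1,\dots,t_n)\in\mathbb{R}^n\mid t_1=0,\ 0\le t_k\le k-1-\sum_{i=1}^{k-1}t_i\ (1<k<n),\ t_n=n-1-\sum_{i=1}^{n-1}t_i\}$, and let $\mathbb{b}_n=(0,\tfrac12,\dots,\tfrac12,\tfrac n2)\in K_n$ (so $\mathbb b_2=(0,1)$ and $K_2=\{\mathbb b_2\}$). For $r,s\ge2$, $r+s=n+1$,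 $1\le k\le r$, the face operator $\partial_k:\mathbb{R}^r\times\mathbb{R}^s\to\mathbb{R}^n$ is the linear map $\partial_k((t_1,\dots,t_r),(u_1,\dots,u_s))=(t_1,\dots,t_{k-1},u_1,\dots,u_{s-1},u_s+t_k,t_{k+1},\dots,t_r)$ (for $k=1$ this reads $(u_1,\dots,u_{s-1},u_s+t_1,t_2,\dots,t_r)$); it maps $K_r\times K_s$ bijectively onto a face $L_k(r,s)$ of $K_n$. The boundary of $K_n$ is the union of these faces, and $K_n$ is the union of the cones $L_k(r,s)\ast\mathbb b_n$ (for $n\ge3$). The cubic complex $\mathbb{K}(n)$ is a finite set of cells $\sigma\subset K_n$, each nonempty cell equipped with a surjection $\pi_\sigma:\mathbb{R}^q\to\sigma$, $q=\dim\sigma$, defined inductively: - $\mathbb{K}(2)=\{\emptyset,\{\mathbb b_2\}\}$. - For $n\ge3$, $\mathbb{K}(n)$ consists of $\emptyset$, $\{\mathbb b_n\}$, all cells $\sigma=\partial_k(\rho\times\kappa)$ with $r+s=n+1$, $r,s\ge 2$, $1\le k\le r$ and nonempty $\rho\in\mathbb{K}(r)$, $\kappa\in\mathbb{K}(s)$, where $\pi_\sigma=\partial_k\circ(\pi_\rho\times\pi_\kappa)$, and all joins $\sigma\ast\mathbb b_n=\{(1-t)x+t\,\mathbb b_n\mid x\in\sigma,\ t\in[0,1]\}$ of such $\sigma$, where $\pi_{\sigma\ast\mathbb b_n}(x,t)=(1-\pi_{set}(t))\pi_\sigma(x)+\pi_{set}(t)\,\mathbb b_n$ for $(x,t)\in\mathbb{R}^{\dim\sigma}\times\mathbb{R}$.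 Each cell $\sigma$ carries the diffeology for which $\pi_\sigma$ is a subduction (one-point cells are trivial). $|\mathbb{K}(n)|$ is $K_n$ as a set, with the diffeology of the colimit of the cells (the finest diffeology for which all inclusions of cells are smooth). **Internal h-unital $A_\infty$-category.** An internal precategory $(G,X)$ is a pair of diffeological spaces with smooth maps $\sigma,\tau:G\to X$ and $\iota:X\to G$ satisfying $\sigma\circ\iota=\tau\circ\iota=\mathrm{id}_X$. Write $G^n=\{(g_1,\dots,g_n)\mid g_i\in G,\ \tau(g_i)=\sigma(g_{i+1})\ (1\le i<n)\}$, the iterated pullback over $X$, as a subspace of the $n$-fold product of $G$. $(G,X)$ is an internal smooth h-unital $A_\infty$-category if there is a series of smooth maps $\{M(n):|\mathbb{K}(n)|\times G^n\to G\}_{n\ge2}$ (an $A_\infty$-form) such that: (0) $\sigma(M(n)(a;g_1,\dots,g_n))=\sigma(g_1)$ and $\tau(M(n)(a;g_1,\dots,g_n))=\tau(g_n)$ for all $a\in|\mathbb{K}(n)|$, $(g_1,\dots,g_n)\in G^n$; (1) $M(n)(\partial_k(\rho,\kappa);g_1,\dots,g_n)=M(r)(\rho;g_1,\dots,g_{k-1},M(s)(\kappa;g_k,\dots,g_{k+s-1}),g_{k+s},\dots,g_n)$ for all $r,s\ge2$, $r+s=n+1$, $1\le k\le r$, $\rho\in|\mathbb{K}(r)|$, $\kappa\in|\mathbb{K}(s)|$, $(g_1,\dots,g_n)\in G^n$; (2') the maps $G\to G$, $g\mapsto M(2)(\mathbb b_2;\iota(\sigma(g)),g)$ and $g\mapsto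 M(2)(\mathbb b_2;g,\iota(\tau(g)))$ are each smoothly homotopic to the identity of $G$. *)

(* Defs.v *)
From mathcomp Require Import all_boot all_order all_algebra.
From mathcomp Require Import zify ring lra.
From mathcomp Require Import all_classical all_reals all_analysis.
Set Implicit Arguments.
Unset Strict Implicit.
Unset Printing Implicit Defensive.
Import Order.TTheory GRing.Theory Num.Theory.
Import numFieldNormedType.Exports.
Local Open Scope classical_set_scope.
Local Open Scope ring_scope.

Section Smooth.
Context {R : realType}.

(* C^k for real functions on an open subset U of R^m (m = 0 included): the
   iterated directional derivatives exist and are continuous on U. *)
Fixpoint Ck m (k : nat) (U : set 'rV[R]_m) (f : 'rV[R]_m -> R) : Prop :=
  if k is k'.+1 then
    (forall x, U x -> differentiable f x) /\ (forall v, Ck k' U ('D_v f))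
  else forall x, U x -> {for x, continuous f}.

Definition smooth_fun m (U : set 'rV[R]_m) (f : 'rV[R]_m -> R) : Prop :=
  forall k, Ck k U f.

Definition smooth_map m n (U : set 'rV[R]_m) (h : 'rV[R]_m -> 'rV[R]_n) : Prop :=
  forall j, smooth_fun U (fun x => h x 0 j).

Lemma Ck_sub m k (U V : set 'rV[R]_m) f : V `<=` U -> Ck k U f -> Ck k V f.
Proof.
move=> VU; elim: k f => [|k IH] f /=; first by move=> fU x /VU /fU.
by move=> [df Df]; split=> [x /VU /df //|v]; exact: IH.
Qed.

Lemma Ck_local m k (U : set 'rV[R]_m) f :
  (forall x, U x -> exists V, V x /\ Ck k V f) -> Ck k U f.
Proof.
elim: k f => [|k IH] f /= H; first by move=> x /H [V [Vx]]; exact.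
split=> [x /H [V [Vx [+ _]]]|v]; first exact.
by apply: IH => x /H [V [Vx [_ /(_ v)]]] ?; exists V.
Qed.

Lemma CkW m k (U : set 'rV[R]_m) f : Ck k.+1 U f -> Ck k U f.
Proof.
elim: k f => [|k IH] f.
  by move=> [df _] x Ux; exact/differentiable_continuous/df.
by move=> [df Df]; split=> // v; exact: IH.
Qed.


Lemma differentiable_near0 m (e : 'rV[R]_m -> R) x :
  (\near x, e x = 0) -> differentiable e x.
Proof.
move=> ex; have ex0 : e x = 0 by exact: nbhs_singleton ex.
have E : e \o shift x = cst (e x) + (\0 : {linear 'rV[R]_m -> R}) +o_ 0 id.
  apply/eqaddoP => eps eps0.
  move: ex; rewrite (near_shift (0 : 'rV[R]_m)) /= subr0 => ex.
  near=> h.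
  have eh : e (h + x) = 0 by near: h.
  rewrite [X in `|X|](_ : _ = e (h + x) - (e x + 0)) //.
  by rewrite eh ex0 addr0 subrr normr0 mulr_ge0 // ltW.
apply/diff_locallyP.
have c0 : continuous (\0 : {linear 'rV[R]_m -> R}) by exact: cst_continuous.
by rewrite (diff_unique c0 E).
Unshelve. all: by end_near. Qed.

Lemma differentiable_near m (f g : 'rV[R]_m -> R) x :
  {near x, f =1 g} -> differentiable f x -> differentiable g x.
Proof.
move=> fg df; rewrite (_ : g = f + (g - f)); last by rewrite addrC subrK.
apply: differentiableD => //; apply: differentiable_near0.
near=> y; rewrite -[LHS]/(g y - f y).
by have -> : f y = g y; [near: y|rewrite subrr].
Unshelve. all: by end_near. Qed.

Lemma near_on_open m (U : set 'rV[R]_m) (P : set 'rV[R]_m) x :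
  open U -> U x -> (forall y, U y -> P y) -> \near x, P x.
Proof. by move=> oU Ux UP; apply: filterS UP _; exact: open_nbhs_nbhs. Qed.

Lemma Ck_ext m k (U : set 'rV[R]_m) f g : open U ->
  (forall x, U x -> f x = g x) -> Ck k U f -> Ck k U g.
Proof.
move=> oU; elim: k f g => [|k IH] f g fg; have nfg x : U x -> {near x, f =1 g}.
- by move=> Ux; exact: (near_on_open oU Ux).
- move=> fc x Ux; have := fc x Ux; rewrite /prop_for /continuous_at -fg //.
  by apply: cvg_trans; exact: near_eq_cvg (nfg x Ux).
- by move=> Ux; exact: (near_on_open oU Ux).
move=> [df Df]; split=> [x Ux|v].
  exact: differentiable_near (nfg x Ux) (df x Ux).
by apply: (IH _ _ _ (Df v)) => x Ux; exact/near_eq_derive/nfg.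
Qed.

Lemma Ck_cst m k (U : set 'rV[R]_m) (c : R) : Ck k U (cst c).
Proof.
elim: k c => [|k IH] c; first by move=> x _; exact: cst_continuous.
split=> [x _|v]; first exact: differentiable_cst.
rewrite (_ : 'D_v _ = cst 0); first exact: IH.
by apply/funext => x; rewrite derive_cst.
Qed.

Lemma CkD m k (U : set 'rV[R]_m) f g : open U ->
  Ck k U f -> Ck k U g -> Ck k U (f + g).
Proof.
move=> oU; elim: k f g => [|k IH] f g.
  by move=> cf cg x Ux; apply: continuousD; [exact: cf|exact: cg].
move=> [df Df] [dg Dg]; split=> [x Ux|v].
  by apply: differentiableD; [exact: df|exact: dg].
apply: Ck_ext (IH _ _ (Df v) (Dg v)) => // x Ux.
by rewrite deriveD //; apply: diff_derivable; [exact: df|exact: dg].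
Qed.

Lemma CkM m k (U : set 'rV[R]_m) f g : open U ->
  Ck k U f -> Ck k U g -> Ck k U (f * g).
Proof.
move=> oU; elim: k f g => [|k IH] f g.
  by move=> cf cg x Ux; apply: continuousM; [exact: cf|exact: cg].
move=> kf kg; have [df Df] := kf; have [dg Dg] := kg; split=> [x Ux|v].
  by apply: differentiableM; [exact: df|exact: dg].
have := CkD oU (IH _ _ (CkW kf) (Dg v)) (IH _ _ (CkW kg) (Df v)).
apply: Ck_ext => // x Ux.
by rewrite deriveM //; apply: diff_derivable; [exact: df|exact: dg].
Qed.

Lemma Ck_sum m k n (U : set 'rV[R]_m) (f : 'I_n -> 'rV[R]_m -> R) : open U ->
  (forall i, Ck k U (f i)) -> Ck k U (\sum_(i < n) f i).
Proof.
move=> oU fk; elim/big_ind: _ => //; first exact: Ck_cst.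
by move=> ? ?; exact: CkD.
Qed.

Lemma differentiable_rV m n (h : 'rV[R]_m -> 'rV[R]_n) x :
  (forall j, differentiable (fun x => h x 0 j) x) -> differentiable h x.
Proof.
move=> dh.
rewrite (_ : h = \sum_(j < n) (fun x => h x 0 j *: delta_mx 0 j)).
  by apply: differentiable_sum => j; exact: differentiableZl.
by apply/funext => y; rewrite fct_sumE [LHS]row_sum_delta.
Qed.

Lemma Ck_continuous m n k (U : set 'rV[R]_m) (h : 'rV[R]_m -> 'rV[R]_n) x :
  (forall j, Ck k U (fun x => h x 0 j)) -> U x -> {for x, continuous h}.
Proof.
move=> hk Ux.
have ck j : {for x, continuous (fun x => h x 0 j)}.
  by move: (hk j); elim: k {hk} => [|k IH]; [exact|move=> /CkW /IH].
rewrite (_ : h = \sum_(j < n) (fun x => h x 0 j *: delta_mx 0 j)); last first.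
  by apply/funext => y; rewrite fct_sumE [LHS]row_sum_delta.
elim/big_ind: _ => [|f g|j _]; first exact: cst_continuous.
  exact: continuousD.
by apply: continuousZr_tmp; exact: ck.
Qed.

Lemma Ck_comp m n k (U : set 'rV[R]_n) (V : set 'rV[R]_m) f h :
  open U -> open V -> (forall x, V x -> U (h x)) ->
  (forall j, Ck k V (fun x => h x 0 j)) -> Ck k U f -> Ck k V (f \o h).
Proof.
move=> oU oV VU; elim: k f => [|k IH] f hk.
  move=> cf x Vx; apply: continuous_comp; first exact: (Ck_continuous hk).
  by apply: cf; exact: VU.
move=> [df Df].
have dh x : V x -> differentiable h x.
  by move=> Vx; apply: differentiable_rV => j; case: (hk j) => + _; exact.
split=> [x Vx|v].
  by apply: differentiable_comp; [exact: dh|exact/df/VU].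
pose s := \sum_(j < n) ('D_v (fun x => h x 0 j) * ('D_(delta_mx 0 j) f \o h)).
apply: (@Ck_ext _ _ _ s) => // [x Vx|]; last first.
  apply: Ck_sum => // j; apply: CkM => //; first exact: (proj2 (hk j) v).
  by apply: (IH _ _ (Df _)) => i; exact/CkW/hk.
have dfh : differentiable f (h x) by exact/df/VU.
rewrite deriveE; last by apply: differentiable_comp; [exact: dh|].
rewrite diff_comp //; last exact: dh.
rewrite /= [X in 'd f _ X]row_sum_delta linear_sum /= /s fct_sumE.
apply: eq_bigr => j _; rewrite linearZ /= -[RHS]/(_ * _); congr (_ * _).
  rewrite -deriveE; last exact: dh.
  rewrite derive_mx; last by apply: diff_derivable; exact: dh.
  by rewrite mxE.
by rewrite -deriveE.
Qed.

Lemma Ck_coord m k (U : set 'rV[R]_m) j : Ck k U (fun x => x 0 j).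
Proof.
have d x : differentiable (fun N : 'rV[R]_m => N 0 j) x.
  exact: differentiable_coord.
case: k => [|k]; first by move=> x _; exact: differentiable_continuous.
split=> [x _ //|v].
rewrite (_ : 'D_v _ = cst (v 0 j)); first exact: Ck_cst.
apply/funext => x.
have : 'D_v (@idfun 'rV[R]_m) x = v by exact: derive_id.
by rewrite derive_mx; [move/matrixP/(_ 0 j); rewrite mxE|exact: derivable_id].
Qed.

Lemma smooth_map_id m (U : set 'rV[R]_m) : smooth_map U id.
Proof. by move=> j k; exact: Ck_coord. Qed.

Lemma smooth_map_continuous m n (U : set 'rV[R]_m) (h : 'rV[R]_m -> 'rV[R]_n) x :
  smooth_map U h -> U x -> {for x, continuous h}.
Proof. by move=> hs; apply: (@Ck_continuous _ _ 0) => j; exact: hs. Qed.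

Lemma smooth_fun_comp m n (U : set 'rV[R]_n) (V : set 'rV[R]_m) f h :
  open U -> open V -> (forall x, V x -> U (h x)) ->
  smooth_map V h -> smooth_fun U f -> smooth_fun V (f \o h).
Proof. by move=> oU oV VU hs fs k; apply: (Ck_comp oU) => // j; exact: hs. Qed.

Lemma smooth_map_comp l m n (U : set 'rV[R]_m) (V : set 'rV[R]_l)
    (g : 'rV[R]_m -> 'rV[R]_n) h :
  open U -> open V -> (forall x, V x -> U (h x)) ->
  smooth_map V h -> smooth_map U g -> smooth_map V (g \o h).
Proof. by move=> oU oV VU hs gs j; exact: (smooth_fun_comp oU oV VU hs (gs j)). Qed.

Lemma open_preimage m n (U : set 'rV[R]_n) (V : set 'rV[R]_m) h :
  open U -> open V -> smooth_map V h -> open (V `&` h @^-1` U).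
Proof.
move=> oU oV hs; rewrite openE => x [Vx Ux]; rewrite /interior.
apply: filterI; first exact: open_nbhs_nbhs.
by apply: (smooth_map_continuous hs Vx); exact: open_nbhs_nbhs.
Qed.

End Smooth.

Section Diffeology.
Context (R : realType).

(* A parametrization of T is a total map 'rV[R]_m -> T together with an open
   domain U; by plot_ext only its values on U matter.  For T empty this omits
   just the parametrizations with empty domain. *)
Record diffeology (T : Type) := Diffeology {
  plot : forall m, set 'rV[R]_m -> ('rV[R]_m -> T) -> Prop ;
  plot_open : forall m (U : set 'rV[R]_m) p, plot U p -> open U ;
  plot_cst : forall m (U : set 'rV[R]_m) (x : T), open U -> plot U (cst x) ;
  plot_ext : forall m (U : set 'rV[R]_m) p q,
    (forall x, U x -> p x = q x) -> plot U p -> plot U q ;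
  plot_glue : forall m (U : set 'rV[R]_m) p, open U ->
    (forall x, U x -> exists V, [/\ V x, V `<=` U & plot V p]) -> plot U p ;
  plot_comp : forall m n (U : set 'rV[R]_m) (V : set 'rV[R]_n) p h,
    plot U p -> open V -> (forall x, V x -> U (h x)) -> smooth_map V h ->
    plot V (p \o h) }.

Lemma plot_sub T (D : diffeology T) m (U V : set 'rV[R]_m) p :
  plot D U p -> open V -> V `<=` U -> plot D V p.
Proof. by move=> pU oV VU; apply: (plot_comp pU oV VU); exact: smooth_map_id. Qed.

Record diffSpace := DiffSpace {
  carrier :> Type ;
  diffeology_of : diffeology carrier }.

Definition is_plot (X : diffSpace) m (U : set 'rV[R]_m) (p : 'rV[R]_m -> X) :=
  plot (diffeology_of X) U p.

Definition smooth (A B : diffSpace) (f : A -> B) : Prop :=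
  forall m (U : set 'rV[R]_m) (p : 'rV[R]_m -> A), is_plot U p -> is_plot U (f \o p).

#[local] Obligation Tactic := idtac.

Program Definition euclidean (n : nat) : diffSpace :=
  DiffSpace (@Diffeology 'rV[R]_n
    (fun m U p => open U /\ smooth_map U p) _ _ _ _ _).
Next Obligation. by move=> n m U p []. Qed.
Next Obligation. by move=> n m U x oU; split=> // j k; exact: Ck_cst. Qed.
Next Obligation.
move=> n m U p q pq [oU pU]; split=> // j k.
by apply: Ck_ext (pU j k) => // y Uy /=; rewrite pq.
Qed.
Next Obligation.
move=> n m U p oU pU; split=> // j k; apply: Ck_local => x /pU [V [Vx _ [_ pV]]].
by exists V; split=> //; exact: pV.
Qed.
Next Obligation.
by move=> n m l U V p h [oU pU] oV VU hs; split=> //;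
  exact: (smooth_map_comp oU).
Qed.

Program Definition real_line : diffSpace :=
  DiffSpace (@Diffeology R (fun m U p => open U /\ smooth_fun U p) _ _ _ _ _).
Next Obligation. by move=> m U p []. Qed.
Next Obligation. by move=> m U x oU; split=> // k; exact: Ck_cst. Qed.
Next Obligation.
by move=> m U p q pq [oU pU]; split=> // k; exact: Ck_ext (pU k).
Qed.
Next Obligation.
move=> m U p oU pU; split=> // k; apply: Ck_local => x /pU [V [Vx _ [_ pV]]].
by exists V; split=> //; exact: pV.
Qed.
Next Obligation.
by move=> m l U V p h [oU pU] oV VU hs; split=> //; exact: (smooth_fun_comp oU).
Qed.

Program Definition subspace_diff (X : diffSpace) (A : set X) : diffSpace :=
  DiffSpace (@Diffeology (set_type A)
    (fun m U p => is_plot U (fun x => val (p x))) _ _ _ _ _).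
Next Obligation. by move=> X A m U p; exact: plot_open. Qed.
Next Obligation. by move=> X A m U x; exact: (plot_cst _ (val x)). Qed.
Next Obligation.
by move=> X A m U p q pq pU; apply: plot_ext pU => x /pq ->.
Qed.
Next Obligation. by move=> X A m U p; exact: plot_glue. Qed.
Next Obligation. by move=> X A m n U V p h pU; exact: (plot_comp pU). Qed.

Program Definition prod_diff (A B : diffSpace) : diffSpace :=
  DiffSpace (@Diffeology (A * B)%type
    (fun m U p => is_plot U (fun x => (p x).1) /\ is_plot U (fun x => (p x).2))
    _ _ _ _ _).
Next Obligation. by move=> A B m U p [/plot_open]. Qed.
Next Obligation.
by move=> A B m U x oU; split;
  [exact: (plot_cst _ x.1)|exact: (plot_cst _ x.2)].
Qed.
Next Obligation.
by move=> A B m U p q pq [p1 p2]; split;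
  [apply: plot_ext p1|apply: plot_ext p2] => x /pq ->.
Qed.
Next Obligation.
move=> A B m U p oU pU.
by split; apply: plot_glue => // x /pU [V [Vx VU [? ?]]]; exists V.
Qed.
Next Obligation.
by move=> A B m n U V p h [p1 p2] oV VU hs; split;
  [exact: (plot_comp p1)|exact: (plot_comp p2)].
Qed.

Program Definition tuple_diff (n : nat) (A : diffSpace) : diffSpace :=
  DiffSpace (@Diffeology (n.-tuple A)
    (fun m U p => open U /\ forall i, is_plot U (fun x => tnth (p x) i))
    _ _ _ _ _).
Next Obligation. by move=> n A m U p []. Qed.
Next Obligation.
by move=> n A m U x oU; split=> // i; exact: (plot_cst _ (tnth x i)).
Qed.
Next Obligation.
by move=> n A m U p q pq [oU pU]; split=> // i;
  apply: plot_ext (pU i) => x /pq ->.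
Qed.
Next Obligation.
move=> n A m U p oU pU.
split=> // i; apply: plot_glue => // x /pU [V [Vx VU [_ pV]]].
by exists V; split=> //; exact: pV.
Qed.
Next Obligation.
by move=> n A m l U V p h [oU pU] oV VU hs; split=> // i;
  exact: (plot_comp (pU i)).
Qed.

(* p : U -> C^oo(A, B) is a plot iff (u, a) |-> p u a is smooth on U x A, where
   a plot of U x A is a smooth h into U together with a plot q of A. *)
Program Definition functional_diff (A B : diffSpace) : diffSpace :=
  DiffSpace (@Diffeology (set_type [set f : A -> B | smooth f])
    (fun m U p => open U /\
      forall l (V : set 'rV[R]_l) (h : 'rV[R]_l -> 'rV[R]_m) (q : 'rV[R]_l -> A),
        (forall x, V x -> U (h x)) -> smooth_map V h -> is_plot V q ->
        is_plot V (fun x => val (p (h x)) (q x))) _ _ _ _ _).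
Next Obligation. by move=> A B m U p []. Qed.
Next Obligation.
move=> A B m U f oU; split=> // l V h q _ _.
exact: (set_mem (valP f)).
Qed.
Next Obligation.
move=> A B m U p p' pp' [oU pU]; split=> // l V h q VU hs qV.
by apply: plot_ext (pU l V h q VU hs qV) => x /VU /pp' /= ->.
Qed.
Next Obligation.
move=> A B m U p oU pU; split=> // l V h q VU hs qV; have oV := plot_open qV.
apply: plot_glue => // x Vx; have [W [Wx WU [oW pW]]] := pU _ (VU _ Vx).
have oVW := open_preimage oW oV hs.
exists (V `&` h @^-1` W); split=> //; apply: pW => [y []//||].
  by move=> j k; apply: Ck_sub (hs j k) => y [].
by apply: plot_sub qV oVW _ => y [].
Qed.
Next Obligation.
move=> A B m n U V p h [oU pU] oV VU hs; split=> // l W g q WV gs qW.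
have oW := plot_open qW.
apply: (pU l W (h \o g) q) => // [x /WV /VU //|].
exact: (smooth_map_comp oV).
Qed.

(* The finest diffeology on T for which every f i is smooth. *)
Program Definition final_diff (T : Type) (I : Type) (A : I -> diffSpace)
    (f : forall i, A i -> T) : diffSpace :=
  DiffSpace (@Diffeology T
    (fun m U p => open U /\ forall D : diffeology T,
      (forall i, @smooth (A i) (DiffSpace D) (f i)) -> plot D U p) _ _ _ _ _).
Next Obligation. by move=> T I A f m U p []. Qed.
Next Obligation.
by move=> T I A f m U x oU; split=> // D _; exact: plot_cst.
Qed.
Next Obligation.
by move=> T I A f m U p q pq [oU pU]; split=> // D fD;
  apply: plot_ext (pU D fD).
Qed.
Next Obligation.
move=> T I A f m U p oU pU; split=> // D fD.
apply: plot_glue => // x /pU [V [Vx VU [_ pV]]].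
by exists V; split=> //; exact: pV.
Qed.
Next Obligation.
by move=> T I A f m n U V p h [oU pU] oV VU hs; split=> // D fD;
  exact: (plot_comp (pU D fD)).
Qed.

Definition smoothly_homotopic (A B : diffSpace) (f g : A -> B) : Prop :=
  exists H : prod_diff real_line A -> B,
    [/\ smooth H, forall a, H (0, a) = f a & forall a, H (1, a) = g a].

End Diffeology.

Section Associahedra.
Context (R : realType).

(* Coordinates are numbered from 0. *)
Definition coord n (t : 'rV[R]_n) (i : nat) : R :=
  if insub i is Some j then t 0 j else 0.

Definition associahedron (n : nat) : set 'rV[R]_n :=
  [set t | [/\ coord t 0 = 0,
     (forall k, (0 < k)%N -> (k.+1 < n)%N ->
        0 <= coord t k <= k%:R - \sum_(i < k) coord t i) &
     coord t n.-1 = n.-1%:R - \sum_(i < n.-1) coord t i]].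

(* b_n = (0, 1/2, ..., 1/2, n/2), the cone point of the cubic complex. *)
Definition barycenter (n : nat) : 'rV[R]_n :=
  \row_(i < n) (if i == 0%N :> nat then 0
                else if i.+1 == n then n%:R / 2 else 1 / 2).

(* n, r, s and k index a face L_(k+1)(r, s) of the n-th associahedron. *)
Definition is_face (n r s k : nat) : bool :=
  [&& 1 < r, 1 < s, r + s == n.+1 & k < r]%N.

(* The face operator with k numbered from 0:
   (t_0, ..., t_(k-1), u_0, ..., u_(s-2), u_(s-1) + t_k, t_(k+1), ..., t_(r-1)). *)
Definition face n r s (k : nat) (t : 'rV[R]_r) (u : 'rV[R]_s) : 'rV[R]_n :=
  \row_(i < n) (if (i < k)%N then coord t i
                else if (i.+1 < k + s)%N then coord u (i - k)
                else if i.+1 == (k + s)%N then coord u s.-1 + coord t k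
                else coord t (i.+1 - s)).

Definition pi_set (t : R) : R := Num.max 0 (Num.min 1 t).

Lemma pi_set_itv t : 0 <= pi_set t <= 1.
Proof. by rewrite /pi_set le_max lexx /= ge_max ler01 ge_min lexx. Qed.

Lemma pi_set_id t : 0 <= t <= 1 -> pi_set t = t.
Proof. by move=> /andP[t0 t1]; rewrite /pi_set (min_idPr t1) (max_idPr t0). Qed.

Lemma coord_row n (f : nat -> R) i :
  (i < n)%N -> coord (\row_(j < n) f j) i = f i.
Proof. by move=> ltin; rewrite /coord insubT mxE. Qed.

Lemma coord_lin n (t u : 'rV[R]_n) (a b : R) i :
  coord (a *: t + b *: u) i = a * coord t i + b * coord u i.
Proof.
by rewrite /coord; case: insubP => [j _ _|_]; rewrite ?mxE ?mulr0 ?addr0.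
Qed.

Lemma associahedronP n (t : 'rV[R]_n) : (1 < n)%N ->
  associahedron t <->
  [/\ forall j, (j < n)%N -> 0 <= coord t j,
      forall j, (j.+1 < n)%N -> \sum_(i < j.+1) coord t i <= j%:R &
      \sum_(i < n) coord t i = n.-1%:R].
Proof.
case: n t => [//|n] t n1 /=; rewrite ltnS in n1.
split=> [[t0 tk tn]|[t0 tk tn]]; last first.
  split.
  - by apply/eqP; rewrite eq_le t0 // andbT; have := tk 0%N n1; rewrite big_ord1.
  - move=> k k0 kn; rewrite t0 1?ltnW //=; have := tk k kn.
    by rewrite big_ord_recr /= lerBrDl.
  - by rewrite -tn /= big_ord_recr /=; ring.
have sk j : (j < n)%N -> \sum_(i < j.+1) coord t i <= j%:R.
  case: j => [|j] jn; first by rewrite big_ord1 t0.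
  by rewrite big_ord_recr /= -lerBrDl; have /andP[] := tk j.+1 isT jn.
split=> [j|//|]; last by rewrite big_ord_recr /= tn addrC subrK.
rewrite ltnS leq_eqVlt => /predU1P[->|jn].
  have sk' m : (m <= n)%N -> \sum_(i < m) coord t i <= m%:R.
    case: m => [|m] mn; first by rewrite big_ord0.
    by apply: le_trans (sk m mn) _; rewrite ler_nat.
  by rewrite tn subr_ge0; exact: sk'.
by case: j jn => [|j] jn; [rewrite t0|have /andP[] := tk j.+1 isT jn].
Qed.

Lemma barycenterP n : (1 < n)%N -> associahedron (barycenter n).
Proof.
move=> n1; have bE i : (i < n)%N -> coord (barycenter n) i =
    if i == 0%N then 0 else if i.+1 == n then n%:R / 2 else 1 / 2.
  move=> ltin; rewrite -(coord_row (fun i => if i == 0%N then _ else _) ltin).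
  by congr coord; apply/rowP => j; rewrite !mxE.
have bS j : (j.+1 < n)%N -> \sum_(i < j.+1) coord (barycenter n) i = j%:R / 2.
  elim: j => [|j IH] jn; first by rewrite big_ord1 bE ?mul0r // ltnW.
  rewrite big_ord_recr /= IH ?bE /=; try by rewrite ltnW.
  by rewrite (ltn_eqF jn) -mulrDl natr1.
apply/associahedronP => //; split.
- move=> j jn; rewrite bE //; case: ifP => // _; case: ifP => _.
    by rewrite divr_ge0.
  by rewrite divr_ge0.
- move=> j jn; rewrite bS // ler_pdivrMr // ler_peMr //.
  by rewrite ler1n.
case: n n1 bE bS => // -[//|n] _ bE bS.
rewrite big_ord_recr /= bS // bE // eqxx /= -mulrDl -!natr1.
by field.
Qed.

Lemma associahedron_convex n (t u : 'rV[R]_n) (a : R) : (1 < n)%N ->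
  0 <= a <= 1 -> associahedron t -> associahedron u ->
  associahedron ((1 - a) *: t + a *: u).
Proof.
move=> n1 /andP[a0 a1] /(associahedronP _ n1)[t0 tk tn].
move=> /(associahedronP _ n1)[u0 uk un].
have a1' : 0 <= 1 - a by rewrite subr_ge0.
apply/associahedronP => //; split=> [j jn|j jn|].
- by rewrite coord_lin addr_ge0 // mulr_ge0 ?t0 ?u0.
- under eq_bigr do rewrite coord_lin.
  rewrite big_split /= -!mulr_sumr.
  rewrite (_ : j%:R = (1 - a) * j%:R + a * j%:R); last by ring.
  by rewrite lerD // ler_wpM2l // ?tk ?uk.
- under eq_bigr do rewrite coord_lin.
  by rewrite big_split /= -!mulr_sumr tn un; ring.
Qed.

Lemma coord_face n r s k (t : 'rV[R]_r) (u : 'rV[R]_s) i : (i < n)%N ->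
  coord (face n k t u) i =
    if (i < k)%N then coord t i
    else if (i.+1 < k + s)%N then coord u (i - k)
    else if i.+1 == (k + s)%N then coord u s.-1 + coord t k
    else coord t (i.+1 - s).
Proof.
move=> ltin; rewrite -(coord_row (fun i => if (i < k)%N then _ else _) ltin).
by congr coord; apply/rowP => j; rewrite !mxE.
Qed.

Lemma sum_face n r s k (t : 'rV[R]_r) (u : 'rV[R]_s) j :
  is_face n r s k -> (j <= n)%N ->
  \sum_(i < j) coord (face n k t u) i =
    if (j <= k)%N then \sum_(i < j) coord t i
    else if (j < k + s)%N then
      \sum_(i < k) coord t i + \sum_(i < j - k) coord u i
    else \sum_(i < j.+1 - s) coord t i + \sum_(i < s) coord u i.
Proof.
move=> /and4P[r1 s1 /eqP rs kr].
elim: j => [|j IH] jn; first by rewrite !big_ord0.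
rewrite big_ord_recr /= IH ?(ltnW jn) // coord_face //.
case: (ltngtP j k) => [jk|kj|->].
- by rewrite big_ord_recr.
- case: (ltngtP j.+1 (k + s)%N) => [js|sj|js].
  + by rewrite subSn ?(ltnW kj) // big_ord_recr /= addrA.
  + rewrite (_ : j.+2 - s = (j.+1 - s).+1)%N; last by lia.
    by rewrite big_ord_recr /= addrAC.
  + rewrite (_ : j.+2 - s = k.+1)%N; last by lia.
    have pS (f : nat -> R) l : (0 < l)%N ->
      \sum_(i < l) f i = \sum_(i < l.-1) f i + f l.-1.
      by case: l => // l _; rewrite big_ord_recr.
    rewrite (pS _ s) ?(ltnW s1) // big_ord_recr /= (_ : j - k = s.-1)%N; last by lia.
    by ring.
- rewrite (_ : (k.+1 < k + s)%N); last by lia.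
  by rewrite subnn subSnn big_ord1.
Qed.

Lemma faceP n r s k (t : 'rV[R]_r) (u : 'rV[R]_s) : is_face n r s k ->
  associahedron t -> associahedron u -> associahedron (face n k t u).
Proof.
move=> h; have /and4P[r1 s1 /eqP rs kr] := h.
move=> /(associahedronP _ r1)[t0 tk tn] /(associahedronP _ s1)[u0 uk un].
apply/associahedronP; first by lia.
have tk' j : (j < r)%N -> \sum_(i < j) coord t i <= j%:R.
  case: j => [|j] jr; first by rewrite big_ord0.
  by apply: le_trans (tk j jr) _; rewrite ler_nat.
have tk2 j : (j < r)%N -> \sum_(i < j.+1) coord t i <= j%:R.
  move=> jr; have [jr'|] := ltnP j.+1 r; first exact: tk.
  move=> rj; have -> : j = r.-1 by lia.
  by rewrite prednK ?tn // ltnW.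
split=> [j jn|j jn|].
- rewrite coord_face //; case: ifPn => jk; first by apply: t0; lia.
  case: ifPn => js; first by apply: u0; lia.
  case: ifPn => js'; last by apply: t0; lia.
  by rewrite addr_ge0 ?t0 ?u0 //; lia.
- rewrite sum_face //; last exact: ltnW.
  case: ifPn => jk; first by apply: tk; lia.
  case: ifPn => js.
    rewrite (_ : j = k + (j - k))%N; last by lia.
    rewrite natrD lerD ?tk' // -addnS addKn; apply: uk; lia.
  rewrite un (_ : j = (j.+1 - s) + s.-1)%N; last by lia.
  rewrite natrD lerD // (_ : _ - s = (j.+1 - s).+1)%N; last by lia.
  by apply: tk2; lia.
- rewrite sum_face // !ifF; try lia.
  rewrite un (_ : n.+1 - s = r)%N; last by lia.
  by rewrite tn -natrD; congr _%:R; lia.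
Qed.

(* Codes for the nonempty cells of the cubic complex K(n); the empty cell has
   only empty plots and does not affect the colimit.  Join stands for the join of
   the corresponding Face with the barycenter.  A cell lying in several faces has
   several codes; by associativity of the face operators their parametrizations
   agree up to a permutation of the coordinates, hence define the same diffeology
   on the cell. *)
Inductive cell : nat -> Type :=
| Center n of (1 < n)%N : cell n
| Face n r s k of is_face n r s k & cell r & cell s : cell n
| Join n r s k of is_face n r s k & cell r & cell s : cell n.

Fixpoint cell_dim n (c : cell n) : nat :=
  match c with
  | Center _ _ => 0
  | Face _ _ _ _ _ c1 c2 => cell_dim c1 + cell_dim c2
  | Join _ _ _ _ _ c1 c2 => cell_dim c1 + cell_dim c2 + 1
  end.

Definition face_set n r s k (A : set 'rV[R]_r) (B : set 'rV[R]_s) : set 'rV[R]_n :=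
  [set face n k t u | t in A & u in B].

Definition join_set n (A : set 'rV[R]_n) (b : 'rV[R]_n) : set 'rV[R]_n :=
  [set (1 - t) *: x + t *: b | x in A & t in [set t : R | 0 <= t <= 1]].

Fixpoint cell_set n (c : cell n) : set 'rV[R]_n :=
  match c with
  | Center n _ => [set barycenter n]
  | Face n _ _ k _ c1 c2 => face_set k (cell_set c1) (cell_set c2)
  | Join n _ _ k _ c1 c2 =>
      join_set (face_set k (cell_set c1) (cell_set c2)) (barycenter n)
  end.

Unset Implicit Arguments.
Fixpoint cell_param {n : nat} (c : cell n) : 'rV[R]_(cell_dim c) -> 'rV[R]_n :=
  match c with
  | Center n _ => fun=> barycenter n
  | Face n _ _ k _ c1 c2 => fun x =>
      face n k (cell_param c1 (lsubmx x)) (cell_param c2 (rsubmx x))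
  | Join n _ _ k _ c1 c2 => fun x =>
      let y := lsubmx x in
      let t := pi_set (rsubmx x 0 0) in
      (1 - t) *: face n k (cell_param c1 (lsubmx y)) (cell_param c2 (rsubmx y)) +
      t *: barycenter n
  end.

Set Implicit Arguments.

Lemma cell_paramP n (c : cell n) x : cell_set c (cell_param c x).
Proof.
have faceS m r s k (c1 : cell r) (c2 : cell s) y z :
    cell_set c1 y -> cell_set c2 z ->
    face_set k (cell_set c1) (cell_set c2) (face m k y z).
  by move=> c1y c2z; exists y => //; exists z.
elim: c x => [//|{}n r s k h c1 IH1 c2 IH2|{}n r s k h c1 IH1 c2 IH2] x /=.
  exact: faceS.
exists (face n k (cell_param c1 (lsubmx (lsubmx x)))
                 (cell_param c2 (rsubmx (lsubmx x)))); first exact: faceS.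
by exists (pi_set (rsubmx x 0 0)) => //; exact: pi_set_itv.
Qed.

Lemma cell_param_surj n (c : cell n) y :
  cell_set c y -> exists x, cell_param c x = y.
Proof.
elim: c y => [{}n h|{}n r s k h c1 IH1 c2 IH2|{}n r s k h c1 IH1 c2 IH2] y /=.
- by move=> ->; exists 0.
- move=> [t /IH1[a <-]] [u /IH2[b <-]] <-.
  by exists (row_mx a b); rewrite row_mxKl row_mxKr.
- move=> [_ [t /IH1[a <-]] [u /IH2[b <-]] <-] [w w01] <-.
  exists (row_mx (row_mx a b) (const_mx w)).
  by rewrite !(row_mxKl, row_mxKr) mxE pi_set_id.
Qed.

Lemma cell_gt1 n (c : cell n) : (1 < n)%N.
Proof. by case: c => // {}n r s k /and4P[]; lia. Qed.

Lemma cell_sub n (c : cell n) : cell_set c `<=` associahedron (n := n).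
Proof.
elim: c => [{}n h|{}n r s k h c1 IH1 c2 IH2|{}n r s k h c1 IH1 c2 IH2] y /=.
- by move=> ->; exact: barycenterP.
- by move=> [t /IH1 ?] [u /IH2 ?] <-; exact: faceP.
- move=> [_ [t /IH1 ?] [u /IH2 ?] <-] [w w01] <-.
  have n1 : (1 < n)%N := cell_gt1 (Face h c1 c2).
  by apply: associahedron_convex => //; [exact: faceP|exact: barycenterP].
Qed.

(* When f is surjective this is the diffeology making f a subduction. *)
Definition pushforward_diff (A : diffSpace R) (T : Type) (f : A -> T) :=
  @final_diff R T unit (fun=> A) (fun=> f).

Definition cell_proj n (c : cell n) (x : euclidean R (cell_dim c)) :
    set_type (cell_set c) :=
  exist _ (cell_param c x) (mem_set (cell_paramP x)).

Definition cell_space n (c : cell n) : diffSpace R :=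
  pushforward_diff (@cell_proj n c).

Definition cell_incl n (c : cell n) (x : cell_space c) :
    set_type (associahedron (n := n)) :=
  exist _ (val x) (mem_set (cell_sub (set_mem (valP x)))).

(* |K(n)| *)
Definition cubic_space (n : nat) : diffSpace R :=
  final_diff (@cell_incl n).

Definition cubic_face n r s k (h : is_face n r s k)
    (a : cubic_space r) (b : cubic_space s) : cubic_space n :=
  exist _ (face n k (val a) (val b))
    (mem_set (faceP h (set_mem (valP a)) (set_mem (valP b)))).

Definition cubic_barycenter n (h : (1 < n)%N) : cubic_space n :=
  exist _ (barycenter n) (mem_set (barycenterP h)).

End Associahedra.

Section AinftyCategory.
Context (R : realType) (G X : diffSpace R) (src tgt : G -> X) (idt : X -> G).

Record is_precategory : Prop := IsPrecategory {
  src_smooth : smooth src ;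
  tgt_smooth : smooth tgt ;
  idt_smooth : smooth idt ;
  src_idt : forall x, src (idt x) = x ;
  tgt_idt : forall x, tgt (idt x) = x }.

Definition composable (w : seq G) : Prop :=
  forall g0 i, (i.+1 < size w)%N -> tgt (nth g0 w i) = src (nth g0 w i.+1).

Definition word_space (n : nat) : diffSpace R :=
  @subspace_diff R (tuple_diff n G) [set w | composable (w : n.-tuple G)].

Definition letters n (w : word_space n) : n.-tuple G := val w.

Lemma letters_composable n (w : word_space n) : composable (letters w).
Proof. exact: (set_mem (valP w)). Qed.

Definition mk_word n (w : seq G) (sw : size w == n) (cw : composable w) :
    word_space n :=
  exist _ (Tuple sw) (mem_set cw).

Lemma composable_take_drop k s w : composable w -> composable (take s (drop k w)).
Proof.
move=> cw g0 i; rewrite size_take_min leq_min size_drop => /andP[is_ iw].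
by rewrite !nth_take // 1?ltnW // !nth_drop addnS cw //; lia.
Qed.

Lemma size_take_drop n r s k (h : is_face n r s k) (w : n.-tuple G) :
  size (take s (drop k w)) == s.
Proof.
by have /and4P[r1 s1 /eqP rs kr] := h; rewrite size_takel // size_drop size_tuple; lia.
Qed.

(* (g_1, ..., g_n) |-> (g_(k+1), ..., g_(k+s)) *)
Definition subword n r s k (h : is_face n r s k) (w : word_space n) : word_space s :=
  @mk_word s (take s (drop k (letters w))) (size_take_drop h (letters w))
    (composable_take_drop (k := k) (s := s) (@letters_composable _ w)).

Lemma size_graft n r s k (h : is_face n r s k) (w : n.-tuple G) (g : G) :
  size (take k w ++ g :: drop (k + s) w) == r.
Proof.
have /and4P[r1 s1 /eqP rs kr] := h.
by rewrite size_cat /= size_take size_drop size_tuple; case: ifP; lia.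
Qed.

Lemma composable_graft n r s k (h : is_face n r s k) (w : word_space n) (g : G) :
  (forall g0, src g = src (head g0 (letters (subword h w)))) ->
  (forall g0, tgt g = tgt (last g0 (letters (subword h w)))) ->
  composable (take k (letters w) ++ g :: drop (k + s) (letters w)).
Proof.
have /and4P[r1 s1 /eqP rs kr] := h; have cw := @letters_composable _ w.
move=> /= sg tg g0 i; rewrite (eqP (size_graft h (letters w) g)) => ir.
have sk : size (take k (letters w)) = k by rewrite size_takel // size_tuple; lia.
have {}sg : src g = src (nth g0 (letters w) k).
  by rewrite (sg g0) -nth0 nth_take ?nth_drop ?addn0 // ltnW.
have {}tg : tgt g = tgt (nth g0 (letters w) (k + s).-1).
  rewrite (tg g0) -nth_last (eqP (size_take_drop h _)) nth_take; last by lia.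
  by rewrite nth_drop; congr (tgt (nth _ _ _)); lia.
rewrite !nth_cat sk; case: (ltngtP i.+1 k) => [ik|ki|ik].
- rewrite !nth_take //; last exact: ltnW.
  by apply: cw; rewrite size_tuple; lia.
- have [ik|ik] : (k < i)%N \/ i = k by lia.
    rewrite (_ : i.+1 - k = (i - k).+1)%N; last by lia.
    rewrite (_ : i - k = (i - k).-1.+1)%N /= ?nth_drop; last by lia.
    rewrite addnS; apply: cw; rewrite size_tuple; lia.
  rewrite ik subnn subSnn /= nth_drop addn0 tg.
  rewrite [in RHS](_ : k + s = (k + s).-1.+1)%N; last by lia.
  by apply: cw; rewrite size_tuple; lia.
- rewrite ik subnn /= nth_take; last by lia.
  rewrite sg -ik; apply: cw; rewrite size_tuple; lia.
Qed.

(* (g_1, ..., g_k, g, g_(k+s+1), ..., g_n) *)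
Definition graft n r s k (h : is_face n r s k) (w : word_space n) (g : G)
    (sg : forall g0, src g = src (head g0 (letters (subword h w))))
    (tg : forall g0, tgt g = tgt (last g0 (letters (subword h w)))) :
    word_space r :=
  @mk_word r (take k (letters w) ++ g :: drop (k + s) (letters w))
    (size_graft h (letters w) g) (composable_graft sg tg).

Lemma composable_left_unit (C : is_precategory) g :
  composable [:: idt (src g); g].
Proof. by move=> g0 [|[|//]] //= _; rewrite (tgt_idt C). Qed.

Lemma composable_right_unit (C : is_precategory) g :
  composable [:: g; idt (tgt g)].
Proof. by move=> g0 [|[|//]] //= _; rewrite (src_idt C). Qed.

Definition left_unit_word (C : is_precategory) (g : G) : word_space 2 :=
  @mk_word 2 [:: idt (src g); g] isT (@composable_left_unit C g).

Definition right_unit_word (C : is_precategory) (g : G) : word_space 2 :=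
  @mk_word 2 [:: g; idt (tgt g)] isT (@composable_right_unit C g).

(* head and last do not depend on their default value g0, words having length
   at least 2. *)
Record is_hunital_Ainfty_form (C : is_precategory)
    (M : forall n, (1 < n)%N -> prod_diff (cubic_space R n) (word_space n) -> G) :
    Prop := IsHunitalAinftyForm {
  form_smooth : forall n (hn : (1 < n)%N), smooth (M n hn) ;
  form_src : forall n (hn : (1 < n)%N) a (w : word_space n) g0,
    src (M n hn (a, w)) = src (head g0 (letters w)) ;
  form_tgt : forall n (hn : (1 < n)%N) a (w : word_space n) g0,
    tgt (M n hn (a, w)) = tgt (last g0 (letters w)) ;
  form_face : forall n r s k (hn : (1 < n)%N) (hr : (1 < r)%N) (hs : (1 < s)%N)
      (h : is_face n r s k) (a : cubic_space R r) (b : cubic_space R s)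
      (w : word_space n),
    M n hn (cubic_face h a b, w) =
    M r hr (a, graft (form_src hs b (subword h w)) (form_tgt hs b (subword h w))) ;
  form_left_unit : smoothly_homotopic
    (fun g => M 2%N isT (cubic_barycenter R (isT : (1 < 2)%N), left_unit_word C g))
    (fun g => g) ;
  form_right_unit : smoothly_homotopic
    (fun g => M 2%N isT (cubic_barycenter R (isT : (1 < 2)%N), right_unit_word C g))
    (fun g => g) }.

Definition is_hunital_Ainfty_category : Prop :=
  exists (C : is_precategory)
         (M : forall n, (1 < n)%N -> prod_diff (cubic_space R n) (word_space n) -> G),
    is_hunital_Ainfty_form C M.

End AinftyCategory.

Section Paths.
Context (R : realType) (X : diffSpace R).

Definition path_space : diffSpace R :=
  @subspace_diff R (functional_diff (real_line R) X)
    [set u | val u \o @pi_set R = val u].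

Definition path_fun (u : path_space) : R -> X := val (val u).

Definition path_src (u : path_space) : X := path_fun u 0.

Definition path_tgt (u : path_space) : X := path_fun u 1.

Lemma const_smooth (x : X) : @smooth R (real_line R) X (cst x).
Proof. by move=> m U p /plot_open; exact: plot_cst. Qed.

Definition const_map (x : X) : functional_diff (real_line R) X :=
  exist _ (cst x) (mem_set (const_smooth x)).

Definition path_const (x : X) : path_space :=
  exist _ (const_map x) (mem_set (erefl : cst x \o @pi_set R = cst x)).

End Paths.

(* Main.v *)
From mathcomp Require Import all_boot all_order all_algebra.
From mathcomp Require Import zify ring lra.
From mathcomp Require Import all_classical all_reals all_analysis.
Require Import Defs.
Set Implicit Arguments.
Unset Strict Implicit.
Unset Printing Implicit Defensive.
Import Order.TTheory GRing.Theory Num.Theory.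
Import numFieldNormedType.Exports.
Local Open Scope classical_set_scope.
Local Open Scope ring_scope.

(** A product of n paths is their concatenation run by a suitable clock.  Composable
paths g_1, ..., g_n with unit durations concatenate to a map [concat] from [0, n]
to X, and a clock th : R -> [0, n], equal to 0 for t <= 0 and to n for t >= 1,
turns it into the path concat o th.  In a general diffeological space [concat] is
not smooth at the junctions, but concat o th is smooth in all its data as soon as
th locally stays inside one interval [i, i + 1] (lemma [concat_plot]); such clocks
are the plots of the [broken_line].  It thus suffices to find clocks th_a, depending
smoothly on a in |K(n)|, with th of a face (a, b) equal to
insert k th_b o th_a, where [insert] replaces the k-th unit interval by th_b: this
equation is the A-infinity relation (lemma [concat_insert]).

The clocks are built cell by cell ([cell_curve]).  On a face the equation above
dictates them, and they are extended over the cone with vertex the barycenter.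
Straight interpolation between two clocks may cross a junction at unit speed, so
the extension uses the smooth map [stall], which maps every [i, i + 1] to itself and
is constant near every integer.  The cone first moves th to stall o th by
interpolation, which never leaves an interval [i, i + 1]; it then interpolates
under [stall], where any smooth function is allowed (lemma [broken_cone]).

Cells overlap, so the clock of a point must be shown independent of its cell
(lemma [cell_curve_determined], by induction on n).  A face of K_n records an
excursion of the partial sums of coordinates below a level, and two excursions of
the same point are nested or disjoint (lemma [excursion_laminar]).  The point then
lies on an iterated face, and insertion obeys the two associativity laws of face
operators.  Off the boundary, a point determines its ray from the barycenter, as
no point of a face is a proper convex combination of a point of K_n with the
barycenter.  Conversely every point of K_n is in a cell (lemma
[associahedron_ray]), so the clocks are defined on all of |K(n)|; smoothness is
tested on cells, |K(n)| having a final diffeology.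

For the units, the product of g with a constant path is g run by a new clock, which
is deformed linearly to the identity (lemma [homotopic_id]). *)

(** * A smooth step function *)

Section SmoothStep.
Context {R : realType}.
Implicit Types (j k m : nat).

(** x^(-j) exp(-1/x), extended by 0.  All powers j are treated together because the
family is stable under differentiation up to linear combinations. *)
Definition flat j (x : R) : R := if 0 < x then x^-1 ^+ j * expR (- x^-1) else 0.

Lemma flat_gt0 j (x : R) : 0 < x -> flat j x = x^-1 ^+ j * expR (- x^-1).
Proof. by rewrite /flat => ->. Qed.

Lemma flat_le0 j (x : R) : x <= 0 -> flat j x = 0.
Proof. by rewrite /flat ltNge => ->. Qed.

Lemma flat_pos j (x : R) : 0 < x -> 0 < flat j x.
Proof. by move=> x0; rewrite flat_gt0 // mulr_gt0 ?expR_gt0 // exprn_gt0 // invr_gt0. Qed.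

Lemma flat_ge0 j (x : R) : 0 <= flat j x.
Proof. by case: (ltP 0 x) => x0; [exact/ltW/flat_pos|rewrite flat_le0]. Qed.

(** Comparing exp(1/x) with one term of its series; the square is what makes the
derivative at 0 vanish. *)
Lemma flat_bound j (x : R) : flat j x <= (j.+2)`!%:R * x ^+ 2.
Proof.
case: (ltP 0 x) => x0; last by rewrite flat_le0 // mulr_ge0 // sqr_ge0.
have xV : 0 <= x^-1 by rewrite invr_ge0 ltW.
rewrite flat_gt0 // expRN ler_pdivrMr ?expR_gt0 //.
have /(le_trans _) := @expR_ge1Dxn R x^-1 j.+1 xV.
move=> /(_ (x^-1 ^+ j.+2 / (j.+2)`!%:R)); rewrite lerDr ler01 => /(_ isT) E.
have -> : x^-1 ^+ j = (j.+2)`!%:R * x ^+ 2 * (x^-1 ^+ j.+2 / (j.+2)`!%:R).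
  have f0 : (j.+2)`!%:R != 0 :> R by rewrite pnatr_eq0 -lt0n fact_gt0.
  rewrite -[j.+2]addn2 exprD mulrCA mulrA -[RHS]mulrA; field.
  by rewrite addn2 f0 gt_eqF.
by rewrite ler_wpM2l // mulr_ge0 // sqr_ge0.
Qed.

Lemma is_derive_flat j (x : R) :
  is_derive x 1 (flat j) (flat j.+2 x - j%:R * flat j.+1 x).
Proof.
case: (ltgtP x 0) => [x0|x0|->].
- rewrite !flat_le0 ?(ltW x0) // mulr0 subr0.
  apply: (@near_eq_is_derive _ _ _ (cst 0)).
  near=> y; rewrite flat_le0 // ltW //; near: y; exact: lt_nbhsl.
- pose g y : R := y^-1 ^+ j * expR (- y^-1).
  apply: (@near_eq_is_derive _ _ _ g).
    near=> y; rewrite flat_gt0 //; near: y; exact: lt_nbhsr.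
  have x_neq0 : x != 0 by rewrite gt_eqF.
  have dV : is_derive x 1 (GRing.inv : R -> R) (- x ^- 2).
    have := @is_deriveV R id x 1 1 x_neq0 (is_derive_id _ _).
    by rewrite /= [_ *: _]mulr1.
  have dE : is_derive x 1 (fun y : R => expR (- y^-1)) (expR (- x^-1) * x ^- 2).
    have dN : is_derive x 1 (fun y : R => - y^-1) (x ^- 2).
      by have := is_deriveN dV; rewrite opprK.
    exact: (@is_derive1_comp _ (@expR R) (fun y : R => - y^-1)).
  have dX : is_derive x 1 (fun y : R => y^-1 ^+ j) (- (j%:R * x^-1 ^+ j.+1)).
    have -> : (fun y : R => y^-1 ^+ j) = (GRing.inv : R -> R) ^+ j.
      by rewrite exprfctE.
    apply: (is_derive_eq (is_deriveX j dV)).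
    rewrite -[LHS]/(_ * _) -!exprVn; case: (j) => [|i] /=; first by rewrite !mul0r oppr0.
    by rewrite !exprS expr0; ring.
  apply: (is_derive_eq (is_deriveM dX dE)).
  rewrite !flat_gt0 // -![_ *: _]/(_ * _) -!exprVn !exprS expr0; ring.
- rewrite !flat_le0 // mulr0 subr0.
  have C0 : (0 : R) < (j.+2)`!%:R by rewrite ltr0n fact_gt0.
  have H : (fun h : R => h^-1 *: ((flat j \o shift 0) (h *: 1) - flat j 0)) @ 0^' --> (0 : R).
    apply/cvgr0Pnorm_le => e e0; near=> h.
    have h0 : h != 0 by near: h; exact: nbhs_dnbhs_neq.
    rewrite /= [flat j 0]flat_le0 // subr0 addr0 normrZ normfV [h *: 1]mulr1.
    rewrite ler_pdivrMl ?normr_gt0 //.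
    rewrite ger0_norm ?flat_ge0 // (le_trans (flat_bound j h)) //.
    rewrite -normr_id -[h ^+ 2]real_normK ?num_real // expr2 normr_id mulrA mulrC.
    rewrite ler_wpM2l // -ler_pdivlMl //.
    near: h; apply: dnbhs0_le; by rewrite mulr_gt0 // invr_gt0.
  split; first by apply/cvg_ex; exists 0.
  exact: (cvg_lim _ H).
Unshelve. all: by end_near. Qed.

(** The chain rule expresses a derivative of flat j o f by flat (j + 2) o f and
flat (j + 1) o f, so the induction on k is for all j at once. *)
Lemma Ck_flat m k j (U : set 'rV[R]_m) (f : 'rV[R]_m -> R) : open U ->
  Ck k U f -> Ck k U (flat j \o f).
Proof.
have df y i : differentiable (flat i) y.
  by apply/derivable1_diffP; case: (is_derive_flat i y).
move=> oU; elim: k j f => [|k IH] j f cf.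
  move=> x Ux; apply: continuous_comp; first exact: cf.
  exact/differentiable_continuous.
have [dif Dif] := cf; split=> [x Ux|v].
  by apply: differentiable_comp; first exact: dif.
pose g := (flat j.+2 \o f) * 'D_v f +
   cst (- j%:R) * ((flat j.+1 \o f) * 'D_v f).
apply: (@Ck_ext _ _ _ _ g) => // [x Ux|].
  rewrite deriveE; last by apply: differentiable_comp; first exact: dif.
  rewrite diff_comp //; last exact: dif.
  rewrite /= diff1E // -deriveE; last exact: dif.
  rewrite derive1E; have [_ ->] := is_derive_flat j (f x).
  rewrite -[RHS]/(_ * _) /g.
  rewrite -[LHS]/(flat j.+2 (f x) * 'D_v f x + - j%:R * (flat j.+1 (f x) * 'D_v f x)).
  ring.
have fk := CkW cf.
apply: CkD => //; first by apply: CkM => //; [exact: IH|exact: Dif].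
by apply: CkM => //; [exact: Ck_cst|apply: CkM => //; [exact: IH|exact: Dif]].
Qed.

Lemma Ck_inv m k (U : set 'rV[R]_m) (f : 'rV[R]_m -> R) : open U ->
  (forall x, U x -> f x != 0) -> Ck k U f -> Ck k U (fun x => (f x)^-1).
Proof.
move=> oU f0; elim: k => [|k IH] cf.
  by move=> x Ux; apply: continuousV; [exact: f0|exact: cf].
have [dif Dif] := cf; split=> [x Ux|v].
  by apply: differentiableV; [exact: dif|exact: f0].
pose g := cst (-1) * ((fun x => (f x)^-1) * ((fun x => (f x)^-1) * 'D_v f)).
apply: (@Ck_ext _ _ _ _ g) => // [x Ux|].
  rewrite deriveV ?f0 //; last by apply: diff_derivable; exact: dif.
  rewrite -[RHS]/(_ * _) -[LHS]/(-1 * ((f x)^-1 * ((f x)^-1 * 'D_v f x))).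
  rewrite -exprVn; ring.
have ik := IH (CkW cf).
apply: CkM => //; first exact: Ck_cst.
by apply: CkM => //; apply: CkM => //; exact: Dif.
Qed.

(** Equal to 0 for x <= 1/3 and to 1 for x >= 2/3: constancy near both 0 and 1 is
what lets pieces be glued smoothly. *)
Definition step (x : R) : R := flat 0 (x - 1 / 3) / (flat 0 (x - 1 / 3) + flat 0 (2 / 3 - x)).

Lemma step_den_gt0 (x : R) : 0 < flat 0 (x - 1 / 3) + flat 0 (2 / 3 - x).
Proof.
case: (ltP 0 (x - 1 / 3)) => x0.
  by rewrite ltr_wpDr ?flat_ge0 // flat_pos.
rewrite ltr_wpDl ?flat_ge0 // flat_pos //; lra.
Qed.

Lemma step_eq0 (x : R) : x <= 1 / 3 -> step x = 0.
Proof. by move=> x0; rewrite /step flat_le0 ?mul0r //; lra. Qed.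

Lemma step_eq1 (x : R) : 2 / 3 <= x -> step x = 1.
Proof.
move=> x0; have := step_den_gt0 x.
rewrite /step [flat 0 (2 / 3 - x)]flat_le0 ?addr0; last by lra.
by move=> d; rewrite divff // gt_eqF.
Qed.

Lemma step_ge0 (x : R) : 0 <= step x.
Proof. by rewrite /step divr_ge0 ?flat_ge0 // ltW // step_den_gt0. Qed.

Lemma step_le1 (x : R) : step x <= 1.
Proof. by rewrite /step ler_pdivrMr ?step_den_gt0 // [leRHS]mul1r lerDl flat_ge0. Qed.

Lemma smooth_fun_sub m (U V : set 'rV[R]_m) (f : 'rV[R]_m -> R) :
  V `<=` U -> smooth_fun U f -> smooth_fun V f.
Proof. by move=> VU fs k; exact: Ck_sub (fs k). Qed.

Lemma smooth_funD m (U : set 'rV[R]_m) (f g : 'rV[R]_m -> R) : open U ->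
  smooth_fun U f -> smooth_fun U g -> smooth_fun U (fun x => f x + g x).
Proof. by move=> oU fs gs k; exact: (CkD oU (fs k) (gs k)). Qed.

Lemma smooth_funM m (U : set 'rV[R]_m) (f g : 'rV[R]_m -> R) : open U ->
  smooth_fun U f -> smooth_fun U g -> smooth_fun U (fun x => f x * g x).
Proof. by move=> oU fs gs k; exact: (CkM oU (fs k) (gs k)). Qed.

Lemma smooth_fun_cst m (U : set 'rV[R]_m) (c : R) : smooth_fun U (fun=> c).
Proof. by move=> k; exact: Ck_cst. Qed.

Lemma smooth_funN m (U : set 'rV[R]_m) (f : 'rV[R]_m -> R) : open U ->
  smooth_fun U f -> smooth_fun U (fun x => - f x).
Proof.
move=> oU fs; rewrite (_ : (fun _ => _) = (fun x => -1 * f x)).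
  by apply: smooth_funM => //; exact: smooth_fun_cst.
by apply/funext => x; rewrite mulN1r.
Qed.

Lemma smooth_funB m (U : set 'rV[R]_m) (f g : 'rV[R]_m -> R) : open U ->
  smooth_fun U f -> smooth_fun U g -> smooth_fun U (fun x => f x - g x).
Proof. by move=> oU fs gs; apply: smooth_funD => //; exact: smooth_funN. Qed.

Lemma smooth_fun_step m (U : set 'rV[R]_m) (f : 'rV[R]_m -> R) : open U ->
  smooth_fun U f -> smooth_fun U (fun x => step (f x)).
Proof.
move=> oU fs.
have f1 : smooth_fun U (fun x => flat 0 (f x - 1 / 3)).
  move=> k; apply: (@Ck_flat _ _ _ _ (fun x => f x - 1 / 3)) => //.
  by apply: smooth_funB => //; exact: smooth_fun_cst.
apply: smooth_funM => // k.
apply: Ck_inv => // [x _|]; first by rewrite gt_eqF // step_den_gt0.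
apply: smooth_funD => // {}k.
apply: (@Ck_flat _ _ _ _ (fun x => 2 / 3 - f x)) => //.
by apply: smooth_funB => //; exact: smooth_fun_cst.
Qed.

End SmoothStep.

(** * The line broken at the integers *)

Section BrokenLine.
Context {R : realType}.
Implicit Types (m n r s k : nat) (i : int).

Lemma open_near m (U : set 'rV[R]_m) (P : set 'rV[R]_m) x : open U -> U x ->
  (\near x, P x) -> exists V, [/\ V x, open V, V `<=` U & V `<=` P].
Proof.
move=> oU Ux Px; exists (U `&` P^°); split.
- by split.
- by apply: openI => //; exact: open_interior.
- by move=> y [].
- by move=> y [_ /interior_subset].
Qed.

Lemma smooth_fun_continuous m (U : set 'rV[R]_m) (f : 'rV[R]_m -> R) x :
  smooth_fun U f -> U x -> {for x, continuous f}.
Proof. by move=> fs Ux; exact: (fs 0%N x Ux). Qed.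

Definition unit_interval_at i : set R := [set x | i%:~R <= x <= i%:~R + 1].

#[local] Obligation Tactic := idtac.

(** The intervals [i, i + 1] glued end to end, with the final diffeology of their
inclusions: a plot with connected domain crosses an integer only by resting at it on
a nonempty open set. *)
Program Definition broken_line : diffSpace R :=
  DiffSpace (@Diffeology R R
    (fun m U p => [/\ open U, smooth_fun U p &
       forall x, U x -> exists i, \near x, unit_interval_at i (p x)]) _ _ _ _ _).
Next Obligation. by move=> m U p []. Qed.
Next Obligation.
move=> m U x oU; split=> // [k|y Uy]; first exact: Ck_cst.
exists (Num.floor x); near=> z; rewrite /unit_interval_at /=.
by have := floor_itv x; rewrite intrD => /andP[-> /ltW ->].
Unshelve. all: by end_near. Qed.
Next Obligation.
move=> m U p q pq [oU pU pl]; split=> // [k|x Ux]; first exact: Ck_ext (pU k).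
have [i ip] := pl x Ux; exists i.
have : \near x, p x = q x by exact: (near_on_open oU Ux).
by move=> E; near=> z; rewrite -(_ : p z = q z); near: z.
Unshelve. all: by end_near. Qed.
Next Obligation.
move=> m U p oU pU; split=> // [k|x /pU [V [Vx _ [_ _]]]]; last exact.
by apply: Ck_local => x /pU [V [Vx _ [_ pV _]]]; exists V.
Qed.
Next Obligation.
move=> m l U V p h [oU pU pl] oV VU hs; split=> // [|x Vx].
  exact: (smooth_fun_comp oU).
have [i ip] := pl _ (VU _ Vx); exists i.
by have hc := smooth_map_continuous hs Vx; exact: (hc _ ip).
Qed.

Definition broken m (U : set 'rV[R]_m) (p : 'rV[R]_m -> R) :=
  plot (diffeology_of broken_line) U p.

Lemma broken_smooth m (U : set 'rV[R]_m) p : broken U p -> smooth_fun U p.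
Proof. by case. Qed.

Lemma broken_piece m (U : set 'rV[R]_m) p x : broken U p -> U x ->
  exists i V, [/\ V x, open V, V `<=` U & forall y, V y -> unit_interval_at i (p y)].
Proof.
move=> [oU _ pl] Ux; have [i ip] := pl x Ux.
by have [V [? ? ? ?]] := open_near oU Ux ip; exists i, V.
Qed.

Lemma broken_in_piece m (U : set 'rV[R]_m) p i : open U -> smooth_fun U p ->
  (forall x, U x -> unit_interval_at i (p x)) -> broken U p.
Proof. by move=> oU ps pi; split=> // x Ux; exists i; exact: near_on_open pi. Qed.

(** A smooth map of the line fixing the integers, preserving each [i, i + 1], and at
rest near every integer. *)
Definition stall (x : R) : R :=
  (Num.floor x)%:~R + step (x - (Num.floor x)%:~R).

(** One formula is valid past both ends of [i, i + 1], since the neighbouring formulas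
are constant there. *)
Lemma stallE i (x : R) : i%:~R - 1 / 3 < x < i%:~R + 4 / 3 ->
  stall x = i%:~R + step (x - i%:~R).
Proof.
move=> /andP[ix xi]; rewrite /stall.
case: (ltP x i%:~R) => xi0.
  rewrite (_ : Num.floor x = i - 1); last first.
    by apply: floor_def; rewrite subrK rmorphB /= xi0 andbT; lra.
  rewrite rmorphB /= step_eq1; last lra.
  by rewrite step_eq0; lra.
case: (ltP x (i%:~R + 1)) => xi1.
  by rewrite (_ : Num.floor x = i) //; apply: floor_def; rewrite rmorphD /= xi0.
rewrite (_ : Num.floor x = i + 1); last first.
  by apply: floor_def; rewrite !rmorphD /= xi1 /=; lra.
rewrite rmorphD /= step_eq0; last lra.
by rewrite step_eq1; lra.
Qed.

Lemma stall_piece_lt i (x : R) : i%:~R - 1 / 3 < x < i%:~R + 4 / 3 ->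
  unit_interval_at i (stall x).
Proof.
move=> xi; rewrite /unit_interval_at /= (stallE xi).
have := step_ge0 (x - i%:~R); have := step_le1 (x - i%:~R); lra.
Qed.

Lemma stall_piece i (x : R) :
  unit_interval_at i x -> unit_interval_at i (stall x).
Proof. by move=> /andP[? ?]; apply: stall_piece_lt; lra. Qed.

Lemma stall_nat n : stall n%:R = n%:R.
Proof.
have E : n%:R = (n : int)%:~R :> R by [].
rewrite E (@stallE n); last by lra.
by rewrite subrr step_eq0 ?addr0 //; lra.
Qed.

Lemma floor_near (x : R) :
  (Num.floor x)%:~R - 1 / 3 < x < (Num.floor x)%:~R + 4 / 3.
Proof. by have := floor_itv x; rewrite intrD => /andP[? ?]; lra. Qed.

Lemma stall_range n (x : R) : 0 <= x <= n%:R -> 0 <= stall x <= n%:R.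
Proof.
move=> /andP[x0 xn].
have := stall_piece_lt (floor_near x); rewrite /unit_interval_at /=.
have f0 : (0 : int) <= Num.floor x by rewrite floor_ge_int.
have f0' : (0 : R) <= (Num.floor x)%:~R by rewrite ler0z.
case: (ltP (Num.floor x) n) => fn.
  have : (Num.floor x + 1)%:~R <= (n : int)%:~R :> R by rewrite ler_int -ltzD1; lia.
  by rewrite rmorphD /= -[n%:~R]/(n%:R) => ? /andP[? ?]; lra.
have -> : x = n%:R.
  apply/eqP; rewrite eq_le xn /=.
  have /andP[/(le_trans _) + _] := floor_itv x; apply.
  by rewrite -[n%:R]/((n : int)%:~R) ler_int.
by rewrite stall_nat ler0n lexx.
Qed.

(** Near a point x, with i the integer part of f x, the values of f stay in the window
of [stallE], which [stall] maps into [i, i + 1]; hence no condition on f but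
smoothness. *)
Lemma broken_stall m (U : set 'rV[R]_m) (f : 'rV[R]_m -> R) : open U ->
  smooth_fun U f -> broken U (fun x => stall (f x)).
Proof.
move=> oU fs; apply: plot_glue => // x Ux.
pose i := Num.floor (f x).
have nx : \near x, i%:~R - 1 / 3 < f x < i%:~R + 4 / 3.
  have fc := smooth_fun_continuous fs Ux.
  have /andP[l1 l2] := floor_near (f x).
  near=> y; apply/andP; split; near: y.
    exact: (fc _ (lt_nbhsr l1)).
  exact: (fc _ (lt_nbhsl l2)).
have [V [Vx oV VU VP]] := open_near oU Ux nx.
exists V; split=> //; apply: (@broken_in_piece _ _ _ i) => //.
  have fV := smooth_fun_sub VU fs.
  move=> k; apply: (@Ck_ext _ _ _ _ (fun y => i%:~R + step (f y - i%:~R))) => //.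
    by move=> y Vy; rewrite -stallE //; exact: VP.
  apply: smooth_funD => //; first exact: smooth_fun_cst.
  apply: smooth_fun_step => //; apply: smooth_funB => //; exact: smooth_fun_cst.
by move=> y Vy; apply: stall_piece_lt; exact: VP.
Unshelve. all: by end_near. Qed.

(** Interpolating with [stall] keeps the values in the interval [i, i + 1] they are in. *)
Lemma broken_relax m (U : set 'rV[R]_m) (f a : 'rV[R]_m -> R) :
  broken U f -> smooth_fun U a -> (forall x, 0 <= a x <= 1) ->
  broken U (fun x => (1 - a x) * f x + a x * stall (f x)).
Proof.
move=> fb as_ a01; have oU := plot_open fb.
apply: plot_glue => // x Ux.
have [i [V [Vx oV VU Vi]]] := broken_piece fb Ux.
exists V; split=> //; apply: (@broken_in_piece _ _ _ i) => //.
  have fs := broken_smooth fb.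
  have Fs := broken_smooth (broken_stall oU fs).
  apply: (smooth_fun_sub VU).
  apply: smooth_funD => //; apply: smooth_funM => //.
  by apply: smooth_funB => //; exact: smooth_fun_cst.
move=> y Vy; have fi := Vi y Vy; have Fi := stall_piece fi.
move: fi Fi; rewrite /unit_interval_at /= => /andP[f1 f2] /andP[F1 F2].
have /andP[a0 a1] := a01 y; set A := a y in a0 a1 *; set F := stall _ in F1 F2 *.
by apply/andP; split; nra.
Qed.

Lemma broken_shift m (U : set 'rV[R]_m) (f : 'rV[R]_m -> R) (c : int) :
  broken U f -> broken U (fun x => f x + c%:~R).
Proof.
move=> fb; have [oU fs fl] := fb; split=> //.
  by apply: smooth_funD => //; exact: smooth_fun_cst.
move=> x Ux; have [i ip] := fl x Ux; exists (i + c); near=> y.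
have : unit_interval_at i (f y) by near: y.
by rewrite /unit_interval_at /= rmorphD /= => /andP[? ?]; lra.
Unshelve. all: by end_near. Qed.

(** * Clocks, insertion and cones *)

(** The clocks of a concatenation of n paths. *)
Record reparam n (f : R -> R) : Prop := Reparam {
  reparam_le0 : forall t, t <= 0 -> f t = 0 ;
  reparam_ge1 : forall t, 1 <= t -> f t = n%:R ;
  reparam_range : forall t, 0 <= f t <= n%:R }.

Lemma reparam_pi_set n f t : reparam n f -> f (pi_set t) = f t.
Proof.
move=> fr; case: (leP t 0) => t0.
  rewrite !(reparam_le0 fr) // /pi_set ge_max lexx /= ge_min t0.
  by rewrite orbT.
case: (leP 1 t) => t1; last by rewrite pi_set_id // !ltW.
by rewrite !(reparam_ge1 fr) // /pi_set le_max le_min lexx t1 orbT.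
Qed.

(** Runs f during [k, k + 1] and unit speed elsewhere.  When f is a clock of total
length s, the three terms add up to x, k + f (x - k) and x + s - 1 on the three
intervals cut by k and k + 1. *)
Definition insert k (f : R -> R) (x : R) : R :=
  Num.min x k%:R + f (x - k%:R) + Num.max (x - k%:R - 1) 0.

Section Insert.
Variables (s k : nat) (f : R -> R).
Hypothesis fr : reparam s f.

Lemma insert_le x : x <= k%:R -> insert k f x = x.
Proof.
move=> xk; rewrite /insert (min_idPl xk) (reparam_le0 fr); last lra.
by rewrite (max_idPr _) ?addr0 //; lra.
Qed.

Lemma insert_mid x : k%:R <= x <= k%:R + 1 -> insert k f x = k%:R + f (x - k%:R).
Proof.
move=> /andP[kx xk]; rewrite /insert (min_idPr kx).
by rewrite (max_idPr _) ?addr0 //; lra.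
Qed.

Lemma insert_ge x : k%:R + 1 <= x -> insert k f x = x + s%:R - 1.
Proof.
move=> kx; rewrite /insert (min_idPr _); last lra.
rewrite (reparam_ge1 fr); last lra.
by rewrite (max_idPl _); lra.
Qed.

Lemma reparam_insert n r g : (r + s = n.+1)%N -> (k < r)%N -> reparam r g ->
  reparam n (insert k f \o g).
Proof.
move=> rs kr gr.
have rsR : r%:R + s%:R = n%:R + 1 :> R by rewrite -natrD rs -natr1.
have krR : k%:R + 1 <= r%:R :> R by rewrite natr1 ler_nat.
have k0 : (0 : R) <= k%:R by exact: ler0n.
have s0 : (0 : R) <= s%:R by exact: ler0n.
split=> [t t0|t t1|t] /=.
- by rewrite (reparam_le0 gr) // insert_le.
- by rewrite (reparam_ge1 gr) // insert_ge //; lra.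
- have /andP[g0 g1] := reparam_range gr t.
  case: (leP (g t) k%:R) => gk.
    by rewrite insert_le // g0 /=; lra.
  case: (leP (k%:R + 1) (g t)) => gk1; first by rewrite insert_ge //; lra.
  rewrite insert_mid; last by rewrite !ltW.
  by have := reparam_range fr (g t - k%:R); lra.
Qed.

End Insert.

End BrokenLine.

Section Reparametrizations.
Context {R : realType}.
Implicit Types (m n r s k : nat) (i : int) (f g h : R -> R).

Lemma natr_pred n : (0 < n)%N -> n.-1%:R = n%:R - 1 :> R.
Proof. by case: n => // n _; rewrite -natr1 addrK. Qed.

(** The counterpart for clocks of the associativity law [face_nested] of faces. *)
Lemma insert_insert_nested s t k j f g (x : R) :
  reparam s f -> reparam t g -> (j < s)%N ->
  insert k (insert j g \o f) x = insert (k + j) g (insert k f x).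
Proof.
move=> fr gr js.
have j0 : (0 : R) <= j%:R by exact: ler0n.
have jsR : j%:R + 1 <= s%:R :> R by rewrite natr1 ler_nat.
have hr : reparam (s + t).-1 (insert j g \o f).
  by apply: (reparam_insert gr _ js fr); lia.
have stR : ((s + t).-1)%:R = s%:R + t%:R - 1 :> R.
  by rewrite natr_pred ?natrD //; lia.
case: (leP x k%:R) => xk.
  rewrite (insert_le hr) // (insert_le fr) // (insert_le gr) // natrD; lra.
case: (leP (k%:R + 1) x) => kx.
  rewrite (insert_ge hr) // (insert_ge fr) // (insert_ge gr) ?natrD ?stR; lra.
rewrite !(@insert_mid _ k) ?ltW //=.
rewrite /insert natrD.
have -> : k%:R + f (x - k%:R) - (k%:R + j%:R) = f (x - k%:R) - j%:R by ring.
by rewrite -addr_minr; ring.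
Qed.

(** The counterpart for clocks of the law [face_disjoint]; the values of
the clocks lie in [0, s] and [0, t], which keeps the two inserted intervals apart. *)
Lemma insert_insert_disjoint s t k j f g (x : R) :
  reparam s f -> reparam t g -> (k < j)%N -> (0 < s)%N ->
  insert k f (insert j g x) = insert (j + s).-1 g (insert k f x).
Proof.
move=> fr gr kj s0.
have kjR : k%:R + 1 <= j%:R :> R by rewrite natr1 ler_nat.
have s0R : (1 : R) <= s%:R by rewrite ler1n.
have jsR : ((j + s).-1)%:R = j%:R + s%:R - 1 :> R.
  by rewrite natr_pred ?natrD //; lia.
case: (leP x j%:R) => xj.
  rewrite (insert_le gr xj) (insert_le gr) //.
  case: (leP x k%:R) => xk; first by rewrite (insert_le fr) //; lra.
  case: (leP (k%:R + 1) x) => kx; first by rewrite (insert_ge fr) //; lra.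
  rewrite insert_mid; last by rewrite !ltW.
  by have := reparam_range fr (x - k%:R); lra.
rewrite [in RHS](insert_ge fr); last by lra.
case: (leP (j%:R + 1) x) => jx.
  rewrite (insert_ge gr jx) (insert_ge gr); last by lra.
  have t0 : (0 : R) <= t%:R by exact: ler0n.
  rewrite (insert_ge fr); lra.
rewrite (@insert_mid _ j); last by lra.
rewrite (@insert_mid _ (j + s).-1); last by lra.
have := reparam_range gr (x - j%:R).
rewrite jsR (_ : x + s%:R - 1 - (j%:R + s%:R - 1) = x - j%:R); last by ring.
move=> g0; rewrite (insert_ge fr); lra.
Qed.

(** The smoothness of a family of clocks that substituting it into another clock
needs. *)
Definition broken_family m (U : set 'rV[R]_m) (F : 'rV[R]_m -> R -> R) :=
  forall V q, open V -> V `<=` U -> smooth_fun V q -> broken V (fun x => F x (q x)).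

Lemma broken_ext m (U : set 'rV[R]_m) (p q : 'rV[R]_m -> R) :
  (forall x, U x -> p x = q x) -> broken U p -> broken U q.
Proof. exact: plot_ext. Qed.

Lemma broken_sub m (U V : set 'rV[R]_m) (p : 'rV[R]_m -> R) :
  broken U p -> open V -> V `<=` U -> broken V p.
Proof. by move=> pU oV VU; exact: plot_sub pU oV VU. Qed.

(** Locally p stays in one interval [i, i + 1], and insertion is there a translation of p
for i != k, and k + F x (p x - k) for i = k. *)
Lemma broken_insert m s k (U : set 'rV[R]_m) F (p : 'rV[R]_m -> R) :
  (forall x, reparam s (F x)) -> broken_family U F -> broken U p ->
  broken U (fun x => insert k (F x) (p x)).
Proof.
move=> Fr Fb pb; have oU := plot_open pb.
apply: plot_glue => // x Ux.
have [i [V [Vx oV VU Vi]]] := broken_piece pb Ux.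
exists V; split=> //; have pV := broken_sub pb oV VU.
have kE : k%:R = (k : int)%:~R :> R by [].
case: (ltgtP i k) => ik.
- apply: broken_ext pV => y /Vi /andP[_ yi].
  rewrite (insert_le (Fr y)) // (le_trans yi) //.
  by rewrite kE -[1]/(1%:~R) -rmorphD /= ler_int; lia.
- have := broken_shift (s%:Z - 1) pV; apply: broken_ext => y /Vi /andP[yi _].
  rewrite (insert_ge (Fr y)); first by rewrite rmorphB /= addrA.
  by apply: le_trans yi; rewrite kE -[1]/(1%:~R) -rmorphD /= ler_int; lia.
- have : broken V (fun x => F x (p x - k%:R) + (k : int)%:~R).
    apply: broken_shift; apply: Fb => //.
    by apply: smooth_funB => //; [exact: broken_smooth|exact: smooth_fun_cst].
  apply: broken_ext => y /Vi; rewrite ik => yk.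
  by rewrite insert_mid // addrC.
Qed.

(** The clock of the cone points before stalling. *)
Definition sweep n (t : R) : R := n%:R * step t.

Lemma reparam_sweep n : reparam n (sweep n).
Proof.
have n0 : (0 : R) <= n%:R by exact: ler0n.
split=> t; rewrite /sweep.
- by move=> t0; rewrite step_eq0 ?mulr0 //; lra.
- by move=> t0; rewrite step_eq1 ?mulr1 //; lra.
- by rewrite mulr_ge0 ?step_ge0 //= ler_piMr ?step_le1.
Qed.

(** The clock at parameter c of the cone from f (c <= 0) to stall o sweep (c >= 1):
step (2 c) reaches 1 at c = 1/3, before step (2 c - 1) leaves 0 at c = 2/3. *)
Definition cone n (c : R) f (t : R) : R :=
  let v := (1 - step (2 * c - 1)) * f t + step (2 * c - 1) * sweep n t in
  (1 - step (2 * c)) * v + step (2 * c) * stall v.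

Lemma reparam_cone n c f : reparam n f -> reparam n (cone n c f).
Proof.
move=> fr; have sr := reparam_sweep n.
set a := step (2 * c); set b := step (2 * c - 1).
split=> t; rewrite /cone -/a -/b.
- move=> t0; rewrite (reparam_le0 fr) // (reparam_le0 sr) // !mulr0 addr0.
  by have -> : stall 0 = 0 :> R := stall_nat 0; rewrite !mulr0 addr0.
- move=> t1; rewrite (reparam_ge1 fr) // (reparam_ge1 sr) // -mulrDl subrK mul1r.
  by rewrite stall_nat; ring.
- have /andP[f0 f1] := reparam_range fr t; have /andP[s0 s1] := reparam_range sr t.
  have := step_ge0 (2 * c); have := step_le1 (2 * c); rewrite -/a => a1 a0.
  have := step_ge0 (2 * c - 1); have := step_le1 (2 * c - 1); rewrite -/b => b1 b0.
  have v : 0 <= (1 - b) * f t + b * sweep n t <= n%:R by apply/andP; split; nra.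
  have := stall_range v; move: v; set v := _ + _; set w := stall v.
  by move=> /andP[v0 v1] /andP[w0 w1]; apply/andP; split; nra.
Qed.

Lemma cone_le0 n c f : c <= 0 -> cone n c f = f.
Proof.
move=> c0; apply/funext => t; rewrite /cone.
by rewrite !step_eq0; [ring|lra|lra].
Qed.

Lemma cone_ge1 n c f : 1 <= c -> cone n c f = stall \o sweep n.
Proof.
move=> c0; apply/funext => t; rewrite /cone !step_eq1; [|lra|lra].
by rewrite subrr !mul0r !mul1r !add0r.
Qed.

Lemma cone_pi_set n c f : cone n (pi_set c) f = cone n c f.
Proof.
case: (leP c 0) => c0.
  rewrite !cone_le0 // /pi_set ge_max lexx /= ge_min c0.
  by rewrite orbT.
case: (leP 1 c) => c1; last by rewrite pi_set_id // !ltW.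
by rewrite !cone_ge1 // /pi_set le_max le_min lexx c1 orbT.
Qed.

Lemma broken_center m n (U : set 'rV[R]_m) q : open U -> smooth_fun U q ->
  broken U (fun x => stall (sweep n (q x))).
Proof.
move=> oU qs; apply: broken_stall => //.
by apply: smooth_funM => //; [exact: smooth_fun_cst|exact: smooth_fun_step].
Qed.

(** For c < 2/3 the cone only relaxes F towards stall o F; for c > 1/3 it is [stall]
of a smooth function.  Both kinds are broken, and the two ranges overlap. *)
Lemma broken_cone m n (U : set 'rV[R]_m) (c q : 'rV[R]_m -> R) F :
  smooth_fun U c -> smooth_fun U q -> broken U (fun x => F x (q x)) ->
  broken U (fun x => cone n (c x) (F x) (q x)).
Proof.
move=> cs qs Fb; have oU := plot_open Fb.
have Fs := broken_smooth Fb.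
have cst_s (z : R) : smooth_fun U (fun=> z) by exact: smooth_fun_cst.
have as_ : smooth_fun U (fun x => step (2 * c x)).
  by apply: smooth_fun_step => //; exact: smooth_funM.
have bs : smooth_fun U (fun x => step (2 * c x - 1)).
  by apply: smooth_fun_step => //; apply: smooth_funB => //; exact: smooth_funM.
have vs : smooth_fun U (fun x => (1 - step (2 * c x - 1)) * F x (q x) +
    step (2 * c x - 1) * sweep n (q x)).
  apply: smooth_funD => //; apply: smooth_funM => //; first exact: smooth_funB.
  by apply: smooth_funM => //; exact: smooth_fun_step.
apply: plot_glue => // x Ux; have cc := smooth_fun_continuous cs Ux.
case: (ltP (c x) (2 / 3)) => cx.
  have [V [Vx oV VU VP]] := open_near oU Ux (cc _ (lt_nbhsl cx)).
  exists V; split=> //.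
  have a01 y : 0 <= step (2 * c y) <= 1 by rewrite step_ge0 step_le1.
  have H := broken_relax (broken_sub Fb oV VU) (smooth_fun_sub VU as_) a01.
  apply: broken_ext H => y /VP /= cy; rewrite /cone (_ : step (2 * c y - 1) = 0).
    by rewrite subr0 mul1r mul0r addr0.
  by apply: step_eq0; lra.
have cx' : 1 / 3 < c x by lra.
have [V [Vx oV VU VP]] := open_near oU Ux (cc _ (lt_nbhsr cx')).
exists V; split=> //.
have := broken_sub (broken_stall oU vs) oV VU.
apply: broken_ext => y /VP /= cy; rewrite /cone (_ : step (2 * c y) = 1).
  by rewrite subrr mul0r mul1r add0r.
by apply: step_eq1; lra.
Qed.

End Reparametrizations.

(** * Faces of the associahedron through partial sums *)

Section AssociahedronFaces.
Context {R : realType}.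
Implicit Types (n r s k j d e q : nat).

(** Face operators, convex combinations and the inequalities of K_n are all simpler on
partial sums than on coordinates. *)
Definition psum n (t : 'rV[R]_n) j : R := \sum_(i < j) coord t i.

Lemma psum0 n (t : 'rV[R]_n) : psum t 0 = 0.
Proof. exact: big_ord0. Qed.

Lemma psumS n (t : 'rV[R]_n) j : psum t j.+1 = psum t j + coord t j.
Proof. exact: big_ord_recr. Qed.

Lemma psum_inj n (t u : 'rV[R]_n) :
  (forall j, (j <= n)%N -> psum t j = psum u j) -> t = u.
Proof.
move=> tu; apply/rowP => i.
have E (v : 'rV[R]_n) : v 0 i = psum v i.+1 - psum v i.
  rewrite psumS addrC addKr /coord; case: insubP => [l _ li|]; last by rewrite ltn_ord.
  by congr (v 0 _); exact/val_inj.
by rewrite !E !tu // ltnW.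
Qed.

Lemma psum_lin n (t u : 'rV[R]_n) (a b : R) j :
  psum (a *: t + b *: u) j = a * psum t j + b * psum u j.
Proof.
rewrite /psum; under eq_bigr do rewrite coord_lin.
by rewrite big_split /= -!mulr_sumr.
Qed.

Lemma psum_row n (f : nat -> R) : f 0%N = 0 ->
  forall j, (j <= n)%N -> psum (\row_(i < n) (f i.+1 - f i)) j = f j.
Proof.
move=> f0; elim=> [|j IH] jn; first by rewrite psum0.
by rewrite psumS IH ?(ltnW jn) // (coord_row (fun i => f i.+1 - f i)) // addrC subrK.
Qed.

Lemma associahedron_psum n (t : 'rV[R]_n) : (1 < n)%N ->
  associahedron t <->
  [/\ forall j, (j < n)%N -> psum t j <= psum t j.+1,
      forall j, (j.+1 < n)%N -> psum t j.+1 <= j%:R &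
      psum t n = n.-1%:R].
Proof.
move=> n1; split=> [/(associahedronP _ n1)[t0 tk tn]|[t0 tk tn]].
  by split=> // j /t0; rewrite psumS lerDl.
apply/associahedronP => //; split=> // j /t0.
by rewrite psumS lerDl.
Qed.

Lemma psum_le n (t : 'rV[R]_n) i j : (1 < n)%N -> associahedron t ->
  (i <= j <= n)%N -> psum t i <= psum t j.
Proof.
move=> n1 /(associahedron_psum _ n1)[t0 _ _] /andP[ij].
rewrite -(subnKC ij); elim: (j - i)%N => [|l IH] jn; first by rewrite addn0.
rewrite addnS in jn *; apply: le_trans (IH (ltnW jn)) (t0 _ jn).
Qed.

Lemma psum_face_lo n r s k (t : 'rV[R]_r) (u : 'rV[R]_s) j :
  is_face n r s k -> (j <= k)%N -> psum (face n k t u) j = psum t j.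
Proof.
move=> h jk; have /and4P[? ? /eqP ? ?] := h.
by rewrite [LHS](sum_face _ _ h) ?jk //; lia.
Qed.

Lemma psum_face_mid n r s k (t : 'rV[R]_r) (u : 'rV[R]_s) j :
  is_face n r s k -> (j < s)%N ->
  psum (face n k t u) (k + j) = psum t k + psum u j.
Proof.
move=> h js; have /and4P[? ? /eqP ? ?] := h.
rewrite [LHS](sum_face _ _ h); last lia.
case: ifPn => jk; last by rewrite ifT ?addKn //; lia.
by have -> : j = 0%N by [lia]; rewrite addn0 psum0 addr0.
Qed.

Lemma psum_face_hi n r s k (t : 'rV[R]_r) (u : 'rV[R]_s) j :
  is_face n r s k -> (k + s + j <= n)%N ->
  psum (face n k t u) (k + s + j) = psum t (k + j).+1 + psum u s.
Proof.
move=> h js; have /and4P[? ? /eqP ? ?] := h.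
rewrite [LHS](sum_face _ _ h) // ifF; last lia.
rewrite ifF; last lia.
by rewrite (_ : (k + s + j).+1 - s = (k + j).+1)%N //; lia.
Qed.

(** For y in K_n, the walk j |-> psum y j - j takes a step -1 from time k to
k + 1, then stays weakly below the level just reached until time k + s, when it is
back at that level or above.  By [face_excursion] and [excursion_face] this describes
the points of K_n in the face L_(k+1)(r, s). *)
Definition excursion n (y : 'rV[R]_n) k s : Prop :=
  (forall j, (j.+1 < s)%N -> psum y (k + j.+1) <= psum y k + j%:R) /\
  psum y k + s.-1%:R <= psum y (k + s).

Lemma psum_last n (t : 'rV[R]_n) : (1 < n)%N -> associahedron t ->
  psum t n = n.-1%:R.
Proof. by move=> n1 /(associahedron_psum _ n1)[]. Qed.

Lemma psum_bound n (t : 'rV[R]_n) j : (j.+1 < n)%N -> associahedron t ->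
  psum t j.+1 <= j%:R.
Proof.
move=> jn; have n1 : (1 < n)%N by lia.
by move=> /(associahedron_psum _ n1)[_ /(_ j jn)].
Qed.

Lemma face_excursion n r s k (t : 'rV[R]_r) (u : 'rV[R]_s) :
  is_face n r s k -> associahedron t -> associahedron u ->
  excursion (face n k t u) k s.
Proof.
move=> h tK uK; have /and4P[r1 s1 /eqP rs kr] := h.
rewrite /excursion (psum_face_lo _ _ h) //; split=> [j js|].
  by rewrite (psum_face_mid _ _ h) // lerD2l psum_bound.
have := psum_face_hi t u h (j := 0); rewrite !addn0 => -> //; last by lia.
rewrite (psum_last s1 uK) lerD2r; apply: psum_le => //; lia.
Qed.

(** The two factors are read off their partial sums ft and fu: u is the part of y in
the window [k, k + s), with the last coordinate lowered to give total s - 1, and t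
collapses that window to the one coordinate that remains. *)
Lemma excursion_face n r s k (y : 'rV[R]_n) :
  is_face n r s k -> associahedron y -> excursion y k s ->
  exists t u, [/\ @associahedron R r t, @associahedron R s u & y = face n k t u].
Proof.
move=> h yK [y1 y2]; have /and4P[r1 s1 /eqP rs kr] := h.
have n1 : (1 < n)%N by lia.
have /(associahedron_psum _ n1)[ym yb yl] := yK.
pose ft j : R := if (j <= k)%N then psum y j else psum y (j + s).-1 - s.-1%:R.
pose fu j : R := if (j < s)%N then psum y (k + j) - psum y k else s.-1%:R.
have ft0 : ft 0%N = 0 by rewrite /ft leq0n psum0.
have fu0 : fu 0%N = 0 by rewrite /fu (ltnW s1) addn0 subrr.
pose t := \row_(i < r) (ft i.+1 - ft i); pose u := \row_(i < s) (fu i.+1 - fu i).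
have tE j : (j <= r)%N -> psum t j = ft j by exact: psum_row.
have uE j : (j <= s)%N -> psum u j = fu j by exact: psum_row.
have tK : associahedron t.
  apply/associahedron_psum => //; split=> [j jr|j jr|].
  - rewrite !tE ?(ltnW jr) // /ft; case: (ltngtP j k) => [jk|jk|->].
    + by apply: ym; lia.
    + by rewrite lerD2r addSn /= -[in leRHS](@prednK (j + s)) ?ym //; lia.
    + by rewrite addSn /= lerBrDr.
  - rewrite tE ?(ltnW jr) // /ft; case: ifPn => jk; first by apply: yb; lia.
    rewrite lerBlDr -natrD addSn /=.
    by rewrite -[(j + s)%N]prednK; [rewrite (le_trans (yb _ _)) ?ler_nat//; lia|lia].
  - rewrite tE // /ft ifF; last lia.
    rewrite (_ : (r + s).-1 = n)%N; last by lia.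
    rewrite yl !natr_pred; [|lia|lia|lia].
    have : r%:R + s%:R = n%:R + 1 :> R by rewrite -natrD rs -natr1.
    lra.
have uK : associahedron u.
  apply/associahedron_psum => //; split=> [j jr|j jr|].
  - rewrite !uE ?(ltnW jr) // /fu jr; case: ifPn => js.
      by rewrite lerD2r addnS; apply: ym; lia.
    have -> : s.-1 = j by lia.
    rewrite lerBlDl; case: j jr js => [|j] jr js; first by rewrite addn0 addr0.
    by rewrite (le_trans (y1 j _)) // lerD2l ler_nat.
  - by rewrite uE ?(ltnW jr) // /fu jr lerBlDl; exact: y1.
  - by rewrite uE // /fu ltnn.
exists t, u; split=> //; apply: psum_inj => j jn.
case: (leqP j k) => jk.
  by rewrite (psum_face_lo _ _ h) // tE ?/ft ?jk //; lia.
case: (ltnP j (k + s)) => js.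
  rewrite -(subnKC (ltnW jk)) (psum_face_mid _ _ h); last lia.
  rewrite tE ?uE /ft /fu ?leqnn; [|lia|lia].
  by rewrite ifT; [rewrite addrC subrK|lia].
rewrite -(subnKC js) (psum_face_hi _ _ h); last lia.
rewrite tE ?uE // /ft /fu ?ltnn; last lia.
rewrite ifF; last by lia.
by rewrite subrK; congr (psum y _); lia.
Qed.

Lemma face_inj n r s k (t t' : 'rV[R]_r) (u u' : 'rV[R]_s) :
  is_face n r s k -> associahedron t -> associahedron t' ->
  associahedron u -> associahedron u' ->
  face n k t u = face n k t' u' -> t = t' /\ u = u'.
Proof.
move=> h tK tK' uK uK' E; have /and4P[r1 s1 /eqP rs kr] := h.
have t_eq j : (j <= k)%N -> psum t j = psum t' j.
  by move=> jk; rewrite -(psum_face_lo t u h jk) E (psum_face_lo _ _ h jk).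
split; apply: psum_inj => j jn.
  case: (leqP j k) => jk; first exact: t_eq.
  have jn' : (k + s + (j - k.+1) <= n)%N by lia.
  have := psum_face_hi t u h jn'; rewrite E (psum_face_hi _ _ h jn').
  rewrite (psum_last _ uK) // (psum_last _ uK') // => /addIr.
  by rewrite -addSn subnKC.
have := jn; rewrite leq_eqVlt => /predU1P[->|js].
  by rewrite (psum_last _ uK) // (psum_last _ uK').
have := psum_face_mid t u h js; rewrite E (psum_face_mid _ _ h js) t_eq //.
by move=> /addrI.
Qed.

(** Both sides are compared on the five ranges of j cut by the two windows. *)
Lemma face_nested n r s k d q a b (t : 'rV[R]_r) (v : 'rV[R]_a) (w : 'rV[R]_q) :
  is_face n r s k -> is_face s a q d -> is_face n b q (k + d) -> is_face b r a k ->
  face n k t (face s d v w) = face n (k + d) (face b k t v) w.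
Proof.
move=> h1 h2 h3 h4.
have /and4P[r1 s1 /eqP rs kr] := h1; have /and4P[a1 q1 /eqP aq dr] := h2.
have /and4P[b1 _ /eqP bq kb] := h3; have /and4P[_ _ /eqP ra _] := h4.
apply: psum_inj => j jn.
case: (leqP j k) => jk.
  by rewrite (psum_face_lo _ _ h1) // (psum_face_lo _ _ h3) ?(psum_face_lo _ _ h4) //; lia.
case: (ltnP j (k + s)) => js.
  rewrite -(subnKC (ltnW jk)); have : (j - k < s)%N by lia.
  move: (j - k)%N => {jk js jn}i js.
  rewrite (psum_face_mid _ _ h1) //.
  case: (leqP i d) => id; first rewrite (psum_face_lo _ _ h2) //.
    by rewrite (psum_face_lo _ _ h3) ?leq_add2l // (psum_face_mid _ _ h4) //; lia.
  case: (ltnP i (d + q)) => iq.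
    rewrite -(subnKC (ltnW id)); have : (i - d < q)%N by lia.
    move: (i - d)%N => l lq.
    by rewrite (psum_face_mid _ _ h2) // addnA (psum_face_mid _ _ h3) //
      (psum_face_mid _ _ h4) // addrA.
  rewrite -(subnKC iq); have : (d + q + (i - (d + q)) < s)%N by lia.
  move: (i - (d + q))%N => l lq.
  rewrite (psum_face_hi _ _ h2) ?(ltnW lq) // !addnA (psum_face_hi _ _ h3); last lia.
  rewrite (_ : (k + d + l).+1 = k + (d + l).+1)%N; last lia.
  by rewrite (psum_face_mid _ _ h4) ?addrA //; lia.
have [i ?] : exists i, j = (k + s + i)%N by exists (j - (k + s))%N; lia.
subst j.
rewrite (psum_face_hi _ _ h1); last lia.
have [l E] : exists l, s = (d + q + l)%N by exists (s - (d + q))%N; lia.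
have -> : psum (face s d v w) s = psum (face s d v w) (d + q + l) by rewrite -E.
rewrite (psum_face_hi _ _ h2); last lia.
rewrite (_ : k + s + i = k + d + q + (l + i))%N; last lia.
rewrite (psum_face_hi _ _ h3); last lia.
rewrite (_ : (d + l).+1 = a)%N; last lia.
rewrite (_ : (k + d + (l + i)).+1 = k + a + i)%N; last lia.
by rewrite (psum_face_hi _ _ h4) ?addrA //; lia.
Qed.

(** The window of w starts at e in the factor of size r, where the window of u is the
single coordinate k < e; inserting u moves it to e + s - 1. *)
Lemma face_disjoint n r s k e q a b (v : 'rV[R]_a) (w : 'rV[R]_q) (u : 'rV[R]_s) :
  is_face n r s k -> is_face r a q e -> is_face n b q (e + s).-1 ->
  is_face b a s k -> (k < e)%N ->
  face n k (face r e v w) u = face n (e + s).-1 (face b k v u) w.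
Proof.
move=> h1 h2 h3 h4 ke.
have /and4P[r1 s1 /eqP rs kr] := h1; have /and4P[a1 q1 /eqP aq dr] := h2.
have /and4P[b1 _ /eqP bq kb] := h3; have /and4P[_ _ /eqP ra _] := h4.
apply: psum_inj => j jn.
case: (leqP j k) => jk.
  by rewrite (psum_face_lo _ _ h1) // (psum_face_lo _ _ h3) ?(psum_face_lo _ _ h4)
    ?(psum_face_lo _ _ h2) //; lia.
case: (ltnP j (k + s)) => js.
  rewrite -(subnKC (ltnW jk)); have : (j - k < s)%N by lia.
  move: (j - k)%N => {jk js jn}i js.
  rewrite (psum_face_mid _ _ h1) // (psum_face_lo _ _ h2) ?(ltnW ke) //.
  by rewrite (psum_face_lo _ _ h3) ?(psum_face_mid _ _ h4) //; lia.
have [i Ej] : exists i, j = (k + s + i)%N by exists (j - (k + s))%N; lia.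
rewrite Ej (psum_face_hi _ _ h1) -?Ej //.
case: (leqP (k + i).+1 e) => ie.
  rewrite (psum_face_lo _ _ h2) // (psum_face_lo _ _ h3); last lia.
  by rewrite Ej (psum_face_hi _ _ h4) //; lia.
have ee : (e + s).-1 = (k + s + (e - k.+1))%N by lia.
have eE : (k + (e - k.+1)).+1 = e by lia.
case: (ltnP (k + i).+1 (e + q)) => iq.
  have [l El] : exists l, (k + i).+1 = (e + l)%N by exists ((k + i).+1 - e)%N; lia.
  rewrite El (psum_face_mid _ _ h2); last lia.
  rewrite (_ : j = (e + s).-1 + l)%N; last lia.
  rewrite (psum_face_mid _ _ h3); last lia.
  rewrite ee (psum_face_hi _ _ h4) ?eE; last lia.
  by rewrite addrAC.
have [l El] : exists l, (k + i).+1 = (e + q + l)%N.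
  by exists ((k + i).+1 - (e + q))%N; lia.
rewrite El (psum_face_hi _ _ h2); last lia.
rewrite (_ : j = (e + s).-1 + q + l)%N; last lia.
rewrite (psum_face_hi _ _ h3); last lia.
rewrite (_ : ((e + s).-1 + l).+1 = k + s + (e - k.+1 + l.+1))%N; last lia.
rewrite (psum_face_hi _ _ h4); last lia.
by rewrite (_ : (k + (e - k.+1 + l.+1)).+1 = (e + l).+1)%N 1?addrAC //; lia.
Qed.

End AssociahedronFaces.

(** * Intersections of faces and rays from the barycenter *)

Section FaceIntersections.
Context {R : realType}.
Implicit Types (n r s k j d e q : nat).

(** If l starts strictly inside the excursion of k and outlasts it, then at time k + s
the walk is still below the level of l, hence strictly below the level
to which the excursion of k should have returned. *)
Lemma excursion_laminar n (y : 'rV[R]_n) k s l q : (1 < s)%N -> (1 < q)%N ->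
  excursion y k s -> excursion y l q ->
  [\/ (k + s <= l)%N, (l + q <= k)%N,
      (k <= l)%N /\ (l + q <= k + s)%N | (l <= k)%N /\ (k + s <= l + q)%N].
Proof.
wlog kl : k s l q / (k <= l)%N.
  move=> W s1 q1 ks lq; case/orP: (leq_total k l) => kl; first exact: W.
  by case: (W _ _ _ _ kl q1 s1 lq ks) => H; [constructor 2|constructor 1|constructor 4|constructor 3].
move=> s1 q1 [k1 k2] [l1 l2].
have [ks|ks] : (k + s <= l)%N \/ (l < k + s)%N by lia.
  by constructor 1.
have [lq|lq] : (l + q <= k + s)%N \/ (k + s < l + q)%N by lia.
  by constructor 3.
have [kl'|kl'] : (k < l)%N \/ k = l by lia.
  exfalso.
  have [a E] : exists a, l = (k + a.+1)%N by exists (l - k.+1)%N; lia.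
  have [b F] : exists b, (k + s = l + b.+1)%N by exists (k + s - l.+1)%N; lia.
  have := k1 a; rewrite -E => /(_ ltac:(lia)) H1.
  have := l1 b; rewrite -F => /(_ ltac:(lia)) H2.
  have : s.-1%:R = (a + b)%:R + 1 :> R by rewrite natr1; congr _%:R; lia.
  rewrite natrD; lra.
by constructor 4; lia.
Qed.

Lemma excursion_inner n r s k d q (t : 'rV[R]_r) (u : 'rV[R]_s) :
  is_face n r s k -> associahedron u -> (1 < q < s)%N -> (d + q <= s)%N ->
  excursion (face n k t u) (k + d) q -> excursion u d q.
Proof.
move=> h uK qs dq [y1 y2]; have /and4P[r1 s1 /eqP rs kr] := h.
have U j : (j < s)%N -> psum u j = psum (face n k t u) (k + j) - psum t k.
  by move=> js; rewrite (psum_face_mid t u h js) addrC addKr.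
split=> [j jq|].
  rewrite !U; [|lia|lia].
  by rewrite addnA; have := y1 j jq; lra.
move: (dq); rewrite leq_eqVlt => /predU1P[E|dq']; last first.
  rewrite !U; [|lia|lia].
  by rewrite addnA; move: y2; lra.
rewrite E (psum_last s1 uK).
have [i di] : exists i, d = i.+1 by exists d.-1; lia.
have := @psum_bound R s u i; rewrite -di => /(_ ltac:(lia) uK) ui.
have : s.-1%:R = i%:R + q%:R :> R by rewrite -natrD; congr _%:R; lia.
have : q.-1%:R <= q%:R :> R by rewrite ler_nat; lia.
lra.
Qed.

Lemma excursion_outer n r s k e q (t : 'rV[R]_r) (u : 'rV[R]_s) :
  is_face n r s k -> (k < e)%N -> (1 < q)%N -> (e + q <= r)%N ->
  excursion (face n k t u) (e + s).-1 q -> excursion t e q.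
Proof.
move=> h ke q1 eq [y1 y2]; have /and4P[r1 s1 /eqP rs kr] := h.
have T j : (k < j <= r)%N -> psum t j = psum (face n k t u) (j + s).-1 - psum u s.
  move=> /andP[kj jr]; have jn : (k + s + (j - k.+1) <= n)%N by lia.
  have := psum_face_hi t u h jn; rewrite -addSn subnKC //.
  rewrite (_ : k + s + (j - k.+1) = (j + s).-1)%N; last lia.
  by move=> ->; rewrite addrK.
have sh j : ((e + s).-1 + j = (e + j + s).-1)%N by lia.
split=> [j jq|].
  by rewrite !T; [have := y1 j jq; rewrite sh; lra|lia|lia].
by rewrite !T; [move: y2; rewrite sh; lra|lia|lia].
Qed.

Lemma psum_barycenter n j : (j.+1 < n)%N -> psum (barycenter R n) j.+1 = j%:R / 2.
Proof.
have bE i : (i < n)%N -> coord (barycenter R n) i =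
    if i == 0%N then 0 else if i.+1 == n then n%:R / 2 else 1 / 2.
  move=> ltin; rewrite -(coord_row (fun i => if i == 0%N then _ else _) ltin).
  by congr coord; apply/rowP => l; rewrite !mxE.
elim: j => [|j IH] jn; first by rewrite psumS psum0 bE ?mul0r ?addr0 //; lia.
rewrite psumS IH ?bE /=; [|lia|lia].
by rewrite (ltn_eqF jn) -mulrDl natr1.
Qed.

(** The barycenter satisfies strictly the inequality that an excursion turns into an
equality: psum (s) <= s - 1 when k = 0, and coordinate k >= 0 otherwise. *)
Lemma no_excursion_interior n r s k (x : 'rV[R]_n) (a : R) :
  is_face n r s k -> associahedron x -> 0 < a <= 1 ->
  ~ excursion ((1 - a) *: x + a *: barycenter R n) k s.
Proof.
move=> h xK /andP[a0 a1]; have /and4P[r1 s1 /eqP rs kr] := h.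
have n1 : (1 < n)%N by lia.
rewrite /excursion => -[y1 y2]; move: y1 y2; case: k h kr => [|k] h kr.
  move=> _; rewrite psum0 !add0r psum_lin.
  have [i E] : exists i, s = i.+2 by exists (s.-2); lia.
  subst s; rewrite psum_barycenter; last lia.
  have := @psum_bound R n x i.+1 ltac:(lia) xK.
  rewrite /= -natr1; have i0 : (0 : R) <= i%:R by exact: ler0n.
  set X := psum _ _ => X1 H; nra.
move=> /(_ 0%N s1) + _; rewrite addn1 !psum_lin !psum_barycenter; [|lia|lia].
have := @psum_le R n x k.+1 k.+2 n1 xK ltac:(lia).
rewrite -natr1; set X := psum _ _; set Y := psum _ _ => XY H; nra.
Qed.

Lemma face_neq_interior n r s k (t : 'rV[R]_r) (u : 'rV[R]_s) x a :
  is_face n r s k -> associahedron t -> associahedron u -> associahedron x ->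
  0 < a <= 1 -> face n k t u <> (1 - a) *: x + a *: barycenter R n.
Proof.
move=> h tK uK xK a01 E; apply: (no_excursion_interior h xK a01).
by rewrite -E; exact: face_excursion.
Qed.

Lemma face_neq_barycenter n r s k (t : 'rV[R]_r) (u : 'rV[R]_s) :
  is_face n r s k -> associahedron t -> associahedron u ->
  face n k t u <> barycenter R n.
Proof.
move=> h tK uK E; have /and4P[r1 s1 /eqP rs kr] := h.
have n1 : (1 < n)%N by lia.
have a01 : 0 < (1 : R) <= 1 by rewrite ltr01 lexx.
apply: (face_neq_interior h tK uK (barycenterP R n1) a01).
by rewrite subrr scale0r scale1r add0r.
Qed.

(** A vanishing coordinate k starts an excursion, and s is its first return; a return
exists because k > 0, and after time 0 the walk never exceeds its final level -1. *)
Lemma zero_coord_face n k (x : 'rV[R]_n) : associahedron x -> (0 < k)%N -> (k.+1 < n)%N ->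
  psum x k.+1 <= psum x k -> exists r s, is_face n r s k /\ excursion x k s.
Proof.
move=> xK k0 kn xk; have n1 : (1 < n)%N by lia.
pose P s := (1 < s)%N && (psum x k + s.-1%:R <= psum x (k + s)).
have Pnk : P (n - k)%N.
  apply/andP; split; first lia.
  rewrite subnKC ?(psum_last n1 xK); last lia.
  have [i E] : exists i, k = i.+1 by exists k.-1; lia.
  have := @psum_bound R n x i; rewrite -E => /(_ ltac:(lia) xK) xi.
  have : n.-1%:R = i%:R + 1 + (n - k).-1%:R :> R by rewrite natr1 -natrD; congr _%:R; lia.
  lra.
have exP : exists s, P s by exists (n - k)%N.
case: (ex_minnP exP) => s /andP[s1 sx] smin.
have sk : (s <= n - k)%N by exact: smin.
exists (n.+1 - s)%N, s; split; first by apply/and4P; split; try (apply/eqP); lia.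
split=> // j js; case: j js => [|j] js; first by rewrite addn1 addr0.
case: (leP (psum x (k + j.+2)) (psum x k + j.+1%:R)) => // /ltW H.
have := smin j.+2; rewrite /P /= H => /(_ isT); lia.
Qed.

(** For k = 0 the excursion is below the level -1, and the inequalities of K_n say
that the walk stays there. *)
Lemma tight_sum_face n j (x : 'rV[R]_n) : associahedron x -> (0 < j)%N -> (j.+1 < n)%N ->
  j%:R <= psum x j.+1 -> exists r s, is_face n r s 0 /\ excursion x 0 s.
Proof.
move=> xK j0 jn xj; exists (n - j)%N, j.+1.
split; first by apply/and4P; split; try (apply/eqP); lia.
split=> [i ij|]; rewrite psum0 add0r ?add0n //.
by apply: psum_bound => //; lia.
Qed.

(** Moving y away from the barycenter until a first inequality of K_n becomes tight
gives x; the parameter a is the least normalized slack of y, and a = 1 forces all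
inequalities to have the slack of the barycenter. *)
Lemma associahedron_ray n (y : 'rV[R]_n) : (1 < n)%N -> associahedron y ->
  y = barycenter R n \/
  exists a x k r s, [/\ 0 <= a <= 1, y = (1 - a) *: x + a *: barycenter R n,
    associahedron x, is_face n r s k & excursion x k s].
Proof.
move=> n1 yK; have bK := barycenterP R n1.
have y1 : psum y 1 = 0.
  have := psum_bound n1 yK; have := @psum_le R n y 0 1 n1 yK ltac:(lia).
  by rewrite psum0 => ? ?; lra.
case: n n1 y yK bK y1 => [//|[//|[|n]]] n1 y yK bK y1.
  left; apply: psum_inj => j; case: j => [|[|[|//]]] _; first by rewrite !psum0.
    by rewrite y1 psum_barycenter // mul0r.
  by rewrite !(psum_last n1).
pose N := n.+3.
(* the slack of an inequality of K_n, scaled to be 1 at the barycenter: for p.1 true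
   the sign of a coordinate, otherwise the bound on a partial sum *)
pose sl (v : 'rV[R]_N) (p : bool * 'I_n.+1) : R :=
  if p.1 then (psum v p.2.+2 - psum v p.2.+1) * 2
  else (p.2.+1%:R - psum v p.2.+2) * (2 / p.2.+1%:R).
case: (arg_minP (P := xpredT) (sl y) (i0 := (true, ord0)) isT) => p _ pmin.
set a := sl y p.
have slb i : sl (barycenter R N) i = 1.
  case: i => [[] [i iN]]; rewrite /sl /=.
    by rewrite !psum_barycenter ?/N; [rewrite -natr1; field|lia|lia].
  rewrite psum_barycenter ?/N; last lia.
  by field; rewrite addrC natr1 pnatr_eq0.
have sl_lin c (v : 'rV[R]_N) i :
    sl ((1 - c) *: v + c *: barycenter R N) i = (1 - c) * sl v i + c.
  transitivity ((1 - c) * sl v i + c * sl (barycenter R N) i); last by rewrite slb mulr1.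
  by case: i => [[] [i iN]]; rewrite /sl /= !psum_lin; ring.
have sl_ge0 : 0 <= a.
  rewrite /a /sl; case: (p) => [[] [i iN]] /=; rewrite mulr_ge0 ?subr_ge0 ?divr_ge0 //.
    by apply: psum_le => //; lia.
  by apply: psum_bound => //; lia.
have a1 : a <= 1.
  have := pmin (true, ord0) isT; have := pmin (false, ord0) isT.
  by rewrite -/a /sl /= y1 => ? ?; lra.
move: a1; rewrite le_eqVlt => /predU1P[a1|a1].
  left; apply: psum_inj => j.
  have pge i : 1 <= sl y i by rewrite -a1; exact: pmin.
  have lo j' : (j' < n.+2)%N -> j'%:R / 2 <= psum y j'.+1.
    elim: j' => [|j' IH] jn; first by rewrite mul0r y1.
    have jn' : (j' < n.+1)%N by lia.
    have := pge (true, Ordinal jn'); rewrite /sl /=.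
    by have := IH (ltnW jn); have : j'%:R + 1 = j'.+1%:R :> R := natr1 j'; lra.
  rewrite leq_eqVlt => /predU1P[->|]; first by rewrite !(psum_last n1).
  case: j => [|[|j]] jN; first by rewrite !psum0.
    by rewrite y1 psum_barycenter // mul0r.
  rewrite psum_barycenter //; apply/eqP; rewrite eq_le lo ?andbT; last lia.
  have jn' : (j < n.+1)%N by lia.
  have := pge (false, Ordinal jn'); rewrite /sl /=.
  have j0 : 0 < j.+1%:R :> R by rewrite ltr0n.
  rewrite mulrA ler_pdivlMr // mul1r; lra.
right; exists a.
have a1' : 0 < 1 - a by lra.
pose x : 'rV[R]_N := (1 - a)^-1 *: (y - a *: barycenter R N).
have yE : y = (1 - a) *: x + a *: barycenter R N.
  by rewrite /x scalerA divff ?gt_eqF // scale1r subrK.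
have slx i : sl x i = (1 - a)^-1 * (sl y i - a).
  rewrite [in RHS]yE sl_lin addrK mulrA mulVf ?mul1r // gt_eqF //.
have slx0 i : 0 <= sl x i.
  by rewrite slx mulr_ge0 ?invr_ge0 ?(ltW a1') // subr_ge0; exact: pmin.
have px j : psum x j = (1 - a)^-1 * (psum y j - a * psum (barycenter R N) j).
  by rewrite yE psum_lin addrK mulrA mulVf ?mul1r // gt_eqF.
have x1 : psum x 1 = 0 by rewrite px y1 psum_barycenter // mul0r mulr0 subrr mulr0.
have xN : psum x N = N.-1%:R.
  rewrite px !(psum_last n1) //; set c := _%:R.
  by rewrite (_ : c - a * c = (1 - a) * c) ?mulKf ?gt_eqF //; ring.
have xb j : (j.+1 < N)%N -> psum x j.+1 <= j%:R.
  case: j => [|j] jN; first by rewrite x1.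
  have jn' : (j < n.+1)%N by move: jN; rewrite /N; lia.
  by have := slx0 (false, Ordinal jn'); rewrite /sl /= pmulr_lge0 ?subr_ge0.
have xK : associahedron x.
  apply/associahedron_psum => //; split=> // j jN.
  case: j jN => [|j] jN; first by rewrite psum0 x1.
  have [jN'|jN'] : (j.+2 < N)%N \/ j.+2 = N by lia.
    have jn' : (j < n.+1)%N by move: jN'; rewrite /N; lia.
    by have := slx0 (true, Ordinal jn'); rewrite /sl /= pmulr_lge0 ?subr_ge0.
  by rewrite jN' xN (le_trans (xb _ _)) // ler_nat /N; lia.
exists x.
have p0 : sl x p = 0 by rewrite slx subrr mulr0.
have [k [r [s [h ex]]]] : exists k r s, is_face N r s k /\ excursion x k s.
  move: p0; rewrite /sl; case: (p) => [[] [i iN]] /= /eqP.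
    rewrite mulf_eq0 pnatr_eq0 orbF subr_eq0 => /eqP E.
    have [r [s H]] : exists r s, is_face N r s i.+1 /\ excursion x i.+1 s.
      by apply: zero_coord_face => //; rewrite E.
    by exists i.+1, r, s.
  rewrite mulf_eq0 subr_eq0 => /orP[/eqP E|]; last first.
    by rewrite mulf_eq0 invr_eq0 !pnatr_eq0.
  by exists 0%N; apply: (@tight_sum_face _ i.+1) => //; rewrite E.
by exists k, r, s; split=> //; rewrite sl_ge0 ltW.
Qed.

End FaceIntersections.

(** * The clocks of the cells *)

Section CellCurves.
Context {R : realType}.
Implicit Types (m n r s k : nat).

(** The clock at the point [cell_param c x]: [insert] on faces, [cone] on joins. *)
Fixpoint cell_curve n (c : cell n) : 'rV[R]_(cell_dim c) -> R -> R :=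
  match c with
  | Center n _ => fun=> stall \o sweep n
  | Face _ _ _ k _ c1 c2 => fun x =>
      insert k (cell_curve (rsubmx x)) \o cell_curve (lsubmx x)
  | Join n _ _ k _ c1 c2 => fun x =>
      let y := lsubmx x in
      cone n (rsubmx x 0 0)
        (insert k (cell_curve (rsubmx y)) \o cell_curve (lsubmx y))
  end.

Lemma cell_param_associahedron n (c : cell n) (x : 'rV[R]_(cell_dim c)) :
  associahedron (cell_param R c x).
Proof. exact: cell_sub (cell_paramP x). Qed.

Lemma reparam_cell_curve n (c : cell n) (x : 'rV[R]_(cell_dim c)) :
  reparam n (cell_curve x).
Proof.
elim: c x => [{}n n1|{}n r s k h c1 IH1 c2 IH2|{}n r s k h c1 IH1 c2 IH2] x /=.
- by rewrite -(@cone_ge1 _ n 1 (sweep n)) //; apply: reparam_cone; exact: reparam_sweep.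
- have /and4P[_ _ /eqP rs kr] := h.
  exact: (reparam_insert (IH2 _) rs kr (IH1 _)).
- have /and4P[_ _ /eqP rs kr] := h; apply: reparam_cone.
  exact: (reparam_insert (IH2 _) rs kr (IH1 _)).
Qed.

(** The ray through y meets a face, whose two factors are covered by induction; the
join with the barycenter then contains y. *)
Lemma cells_cover n (y : 'rV[R]_n) : (1 < n)%N -> associahedron y ->
  exists (c : cell n) x, cell_param R c x = y.
Proof.
elim/ltn_ind: n y => n IH y n1 yK.
have [->|[a [x [k [r [s [a01 -> xK h xe]]]]]]] := associahedron_ray n1 yK.
  by exists (Center n1), 0.
have [t [u [tK uK ->]]] := excursion_face h xK xe.
have /and4P[r1 s1 /eqP rs kr] := h.
have [c1 [x1 <-]] := IH r ltac:(lia) t r1 tK.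
have [c2 [x2 <-]] := IH s ltac:(lia) u s1 uK.
exists (Join h c1 c2), (row_mx (row_mx x1 x2) (const_mx a)) => /=.
by rewrite !(row_mxKl, row_mxKr) mxE pi_set_id.
Qed.

Lemma face_cellE n r s k (h : is_face n r s k) (c1 : cell r) (c2 : cell s)
    (x1 : 'rV[R]_(cell_dim c1)) (x2 : 'rV[R]_(cell_dim c2)) :
  cell_param R (Face h c1 c2) (row_mx x1 x2) =
    face n k (cell_param R c1 x1) (cell_param R c2 x2) /\
  @cell_curve n (Face h c1 c2) (row_mx x1 x2) =
    insert k (cell_curve x2) \o cell_curve x1.
Proof. by rewrite /= row_mxKl row_mxKr. Qed.

(** A face is the end a = 0 of its join, which leaves two kinds of cells to compare. *)
Lemma cell_view n (c : cell n) (x : 'rV[R]_(cell_dim c)) :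
  (cell_param R c x = barycenter R n /\ cell_curve x = stall \o sweep n) \/
  exists r s k (c1 : cell r) (c2 : cell s) x1 x2 a,
    [/\ is_face n r s k, 0 <= a <= 1,
      cell_param R c x = (1 - a) *: face n k (cell_param R c1 x1) (cell_param R c2 x2) +
        a *: barycenter R n &
      cell_curve x = cone n a (insert k (cell_curve x2) \o cell_curve x1)].
Proof.
case: c x => [{}n n1|{}n r s k h c1 c2|{}n r s k h c1 c2] x; first by left.
  right; exists r, s, k, c1, c2, (lsubmx x), (rsubmx x), 0.
  by rewrite lexx ler01 subr0 scale1r scale0r addr0 cone_le0.
right; exists r, s, k, c1, c2, (lsubmx (lsubmx x)), (rsubmx (lsubmx x)).
by exists (pi_set (rsubmx x 0 0)); rewrite cone_pi_set pi_set_itv.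
Qed.

Definition curve_determined n := forall (c c' : cell n)
  (x : 'rV[R]_(cell_dim c)) (x' : 'rV[R]_(cell_dim c')),
  cell_param R c x = cell_param R c' x' -> cell_curve x = cell_curve x'.

Section FaceAgree.
Variable n : nat.
Hypothesis IH : forall m, (m < n)%N -> curve_determined m.

Section TwoFaces.
Variables (r s k r' s' k' : nat).
Hypotheses (h : is_face n r s k) (h' : is_face n r' s' k').
Variables (c1 : cell r) (c2 : cell s) (c1' : cell r') (c2' : cell s').
Variables (x1 : 'rV[R]_(cell_dim c1)) (x2 : 'rV[R]_(cell_dim c2)).
Variables (x1' : 'rV[R]_(cell_dim c1')) (x2' : 'rV[R]_(cell_dim c2')).
Hypothesis E : face n k (cell_param R c1 x1) (cell_param R c2 x2) =
  face n k' (cell_param R c1' x1') (cell_param R c2' x2').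
Let P := cell_param_associahedron.

(** Writing the point as face (t, u) = face (t', u'), there is v with u = face (v, u')
and t' = face (t, v).  The induction hypothesis computes the clocks of u and t' from
those of t, v and u', and associativity of insertion concludes. *)
Lemma face_curve_nested : (s' < s)%N -> (k <= k')%N -> (k' + s' <= k + s)%N ->
  insert k (cell_curve x2) \o cell_curve x1 =
  insert k' (cell_curve x2') \o cell_curve x1'.
Proof.
move=> ss kk ks.
have /and4P[r1 s1 /eqP rs kr] := h; have /and4P[r1' s1' /eqP rs' kr'] := h'.
have Ek : k' = (k + (k' - k))%N by lia.
move: Ek; set d := (k' - k)%N => Ek.
have h2 : is_face s (s.+1 - s') s' d.
  by apply/and4P; split; try (apply/eqP); rewrite ?/d; lia.
have h4 : is_face r' r (s.+1 - s') k.
  by apply/and4P; split; try (apply/eqP); lia.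
have h3 : is_face n r' s' (k + d) by rewrite -Ek.
have y_ex := face_excursion h' (P x1') (P x2'); rewrite -E Ek in y_ex.
have u_ex : excursion (cell_param R c2 x2) d s'.
  by apply: (excursion_inner h (P x2) _ _ y_ex); rewrite ?/d; lia.
have [v [w [vK wK uE]]] := excursion_face h2 (P x2) u_ex.
have a1 : (1 < s.+1 - s')%N by lia.
have [cv [xv vE]] := cells_cover a1 vK.
have [tE wE] : cell_param R c1' x1' = face r' k (cell_param R c1 x1) v /\
    cell_param R c2' x2' = w.
  apply: (face_inj h' (P x1') (faceP h4 (P x1) vK) (P x2') wK).
  by rewrite -E uE (face_nested _ _ _ h h2 h3 h4) -Ek.
have [p2 q2] := face_cellE h2 xv x2'; have [p4 q4] := face_cellE h4 x1 xv.
have -> : cell_curve x2 = insert d (cell_curve x2') \o cell_curve xv.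
  by rewrite -q2; apply: IH; [lia|rewrite p2 vE wE].
have -> : cell_curve x1' = insert k (cell_curve xv) \o cell_curve x1.
  by rewrite -q4; apply: IH; [lia|rewrite p4 vE].
apply/funext => t /=; rewrite Ek.
have dv : (d < s.+1 - s')%N by rewrite /d; lia.
exact: (insert_insert_nested _ _ (reparam_cell_curve xv) (reparam_cell_curve x2') dv).
Qed.

(** As in the nested case, with t = face (v, u') and t' = face (v, u). *)
Lemma face_curve_disjoint : (k + s <= k')%N ->
  insert k (cell_curve x2) \o cell_curve x1 =
  insert k' (cell_curve x2') \o cell_curve x1'.
Proof.
move=> ks.
have /and4P[r1 s1 /eqP rs kr] := h; have /and4P[r1' s1' /eqP rs' kr'] := h'.
have [e Ek] : exists e, k' = (e + s).-1 by exists (k'.+1 - s)%N; lia.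
have ke : (k < e)%N by lia.
have h2 : is_face r (r.+1 - s') s' e by apply/and4P; split; try (apply/eqP); lia.
have h4 : is_face r' (r.+1 - s') s k by apply/and4P; split; try (apply/eqP); lia.
have h3 : is_face n r' s' (e + s).-1 by rewrite -Ek.
have y_ex := face_excursion h' (P x1') (P x2'); rewrite -E Ek in y_ex.
have t_ex : excursion (cell_param R c1 x1) e s'.
  by apply: (excursion_outer h ke s1' _ y_ex); lia.
have [v [w [vK wK tE]]] := excursion_face h2 (P x1) t_ex.
have a1 : (1 < r.+1 - s')%N by lia.
have [cv [xv vE]] := cells_cover a1 vK.
have [tE' wE] : cell_param R c1' x1' = face r' k v (cell_param R c2 x2) /\
    cell_param R c2' x2' = w.
  apply: (face_inj h' (P x1') (faceP h4 vK (P x2)) (P x2') wK).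
  by rewrite -E tE (face_disjoint _ _ _ h h2 h3 h4 ke) -Ek.
have [p2 q2] := face_cellE h2 xv x2'; have [p4 q4] := face_cellE h4 xv x2.
have -> : cell_curve x1 = insert e (cell_curve x2') \o cell_curve xv.
  by rewrite -q2; apply: IH; [lia|rewrite p2 vE wE].
have -> : cell_curve x1' = insert k (cell_curve x2) \o cell_curve xv.
  by rewrite -q4; apply: IH; [lia|rewrite p4 vE].
apply/funext => t /=; rewrite Ek.
exact: (insert_insert_disjoint _ (reparam_cell_curve x2) (reparam_cell_curve x2') ke (ltnW s1)).
Qed.

End TwoFaces.

Lemma face_curve_same r s k (h : is_face n r s k) (c1 c1' : cell r) (c2 c2' : cell s)
    (x1 : 'rV[R]_(cell_dim c1)) (x2 : 'rV[R]_(cell_dim c2))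
    (x1' : 'rV[R]_(cell_dim c1')) (x2' : 'rV[R]_(cell_dim c2')) :
  face n k (cell_param R c1 x1) (cell_param R c2 x2) =
    face n k (cell_param R c1' x1') (cell_param R c2' x2') ->
  insert k (cell_curve x2) \o cell_curve x1 =
  insert k (cell_curve x2') \o cell_curve x1'.
Proof.
have P := cell_param_associahedron.
have /and4P[r1 s1 /eqP rs kr] := h.
move=> /(face_inj h (P _ _ _) (P _ _ _) (P _ _ _) (P _ _ _))[E1 E2].
by rewrite (IH _ E1) ?(IH _ E2) //; lia.
Qed.

Lemma face_curve_agree r s k r' s' k' (h : is_face n r s k) (h' : is_face n r' s' k')
    (c1 : cell r) (c2 : cell s) (c1' : cell r') (c2' : cell s')
    (x1 : 'rV[R]_(cell_dim c1)) (x2 : 'rV[R]_(cell_dim c2))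
    (x1' : 'rV[R]_(cell_dim c1')) (x2' : 'rV[R]_(cell_dim c2')) :
  face n k (cell_param R c1 x1) (cell_param R c2 x2) =
    face n k' (cell_param R c1' x1') (cell_param R c2' x2') ->
  insert k (cell_curve x2) \o cell_curve x1 =
  insert k' (cell_curve x2') \o cell_curve x1'.
Proof.
move=> E; have P := cell_param_associahedron.
have /and4P[r1 s1 /eqP rs kr] := h; have /and4P[r1' s1' /eqP rs' kr'] := h'.
have ex := face_excursion h (P _ _ x1) (P _ _ x2).
have ex' := face_excursion h' (P _ _ x1') (P _ _ x2'); rewrite -E in ex'.
have [Es|Es] := eqVneq s s'.
  have [Ek|Ek] := eqVneq k k'.
    have Er : r = r' by lia.
    by move: h' c1' c2' x1' x2' E {ex' rs' kr' s1' r1'}; rewrite -Er -Es -Ek => h' c1' c2' x1' x2'; exact: face_curve_same.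
  case: (excursion_laminar s1 s1' ex ex') => [H|H|[H1 H2]|[H1 H2]].
  - exact: face_curve_disjoint.
  - by apply/esym; apply: (face_curve_disjoint h' h (esym E)).
  - by lia.
  - by lia.
case: (excursion_laminar s1 s1' ex ex') => [H|H|[H1 H2]|[H1 H2]].
- exact: face_curve_disjoint.
- by apply/esym; apply: (face_curve_disjoint h' h (esym E)).
- by apply: face_curve_nested => //; lia.
- by apply/esym; apply: (face_curve_nested h' h (esym E)) => //; lia.
Qed.

End FaceAgree.

Lemma barycenter_cone n r s k (t : 'rV[R]_r) (u : 'rV[R]_s) (a : R) :
  is_face n r s k -> associahedron t -> associahedron u -> 0 <= a <= 1 ->
  barycenter R n = (1 - a) *: face n k t u + a *: barycenter R n -> a = 1.
Proof.
move=> h tK uK a01 E; apply/eqP; apply: contra_notT (face_neq_barycenter h tK uK) => a1.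
have a1' : 1 - a != 0 by rewrite subr_eq0 eq_sym.
by apply: (scalerI a1'); rewrite [RHS]scalerBl scale1r {1}E addrK.
Qed.

(** If a < a', the point of the first face would be a proper convex combination of a
point of K_n and the barycenter. *)
Lemma cone_injl n r s k r' s' k' (t : 'rV[R]_r) (u : 'rV[R]_s)
    (t' : 'rV[R]_r') (u' : 'rV[R]_s') (a a' : R) :
  is_face n r s k -> is_face n r' s' k' ->
  associahedron t -> associahedron u -> associahedron t' -> associahedron u' ->
  0 <= a <= a' -> a' <= 1 ->
  (1 - a) *: face n k t u + a *: barycenter R n =
  (1 - a') *: face n k' t' u' + a' *: barycenter R n ->
  a = 1 /\ a' = 1 \/ a = a' /\ face n k t u = face n k' t' u'.
Proof.
move=> h h' tK uK tK' uK' /andP[a0 aa] a1 E.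
have [a1'|a_lt1] : a = 1 \/ a < 1 by move: aa a1; case: (ltP a 1); [right|left; lra].
  by left; split=> //; lra.
right; have b0 : 1 - a != 0 by rewrite subr_eq0 gt_eqF.
pose b := (a' - a) / (1 - a).
have fE : face n k t u = (1 - b) *: face n k' t' u' + b *: barycenter R n.
  apply: (scalerI b0); rewrite scalerDr !scalerA.
  rewrite (_ : (1 - a) * (1 - b) = 1 - a'); last by rewrite /b; field.
  rewrite (_ : (1 - a) * b = a' - a); last by rewrite /b; field.
  by rewrite [(a' - a) *: _]scalerBl addrA -E addrK.
have [b_eq0|b_neq0] := eqVneq b 0.
  have aE : a = a'.
    by move/eqP: b_eq0; rewrite /b mulf_eq0 invr_eq0 (negbTE b0) orbF subr_eq0 => /eqP.
  by split=> //; rewrite fE b_eq0 subr0 scale1r scale0r addr0.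
case: (face_neq_interior h tK uK (faceP h' tK' uK') _ fE).
rewrite lt0r b_neq0 /= divr_ge0 ?subr_ge0 ?(ltW a_lt1) //=.
by rewrite ler_pdivrMr ?subr_gt0 // mul1r; lra.
Qed.

(** The clock depends on the point of K_n only, not on the cell chosen to reach it. *)
Lemma cell_curve_determined n : curve_determined n.
Proof.
elim/ltn_ind: n => n IH c c' x x'.
have P := cell_param_associahedron.
have [[-> ->]|[r [s [k [c1 [c2 [x1 [x2 [a [h a01 -> ->]]]]]]]]]] := cell_view x;
have [[-> ->]|[r' [s' [k' [c1' [c2' [x1' [x2' [a' [h' a01' -> ->]]]]]]]]]] := cell_view x'.
- by [].
- by move=> /(barycenter_cone h' (P _ _ _) (P _ _ _) a01') ->; rewrite cone_ge1.
- by move=> /esym /(barycenter_cone h (P _ _ _) (P _ _ _) a01) ->; rewrite cone_ge1.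
move=> E; have /andP[a0 a1] := a01; have /andP[a0' a1'] := a01'.
have [[-> ->]|[-> fE]] : a = 1 /\ a' = 1 \/ a = a' /\
    face n k (cell_param R c1 x1) (cell_param R c2 x2) =
    face n k' (cell_param R c1' x1') (cell_param R c2' x2').
  case/orP: (le_total a a') => aa.
    by apply: (cone_injl h h' _ _ _ _ _ _ E) => //; rewrite a0.
  have := cone_injl h' h (P _ _ x1') (P _ _ x2') (P _ _ x1) (P _ _ x2) _ a1 (esym E).
  by rewrite a0' => /(_ aa)[[-> ->]|[-> ->]]; [left|right].
- by rewrite !cone_ge1.
- by congr cone; exact: (face_curve_agree IH h h' fE).
Qed.

Lemma smooth_lsubmx m a b (V : set 'rV[R]_m) (p : 'rV[R]_m -> 'rV[R]_(a + b)) :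
  smooth_map V p -> smooth_map V (fun x => lsubmx (p x)).
Proof.
move=> ps j; rewrite (_ : (fun _ => _) = (fun x => p x 0 (lshift b j))); first exact: ps.
by apply/funext => x; rewrite mxE.
Qed.

Lemma smooth_rsubmx m a b (V : set 'rV[R]_m) (p : 'rV[R]_m -> 'rV[R]_(a + b)) :
  smooth_map V p -> smooth_map V (fun x => rsubmx (p x)).
Proof.
move=> ps j; rewrite (_ : (fun _ => _) = (fun x => p x 0 (rshift a j))); first exact: ps.
by apply/funext => x; rewrite mxE.
Qed.

Lemma smooth_map_sub m l (U V : set 'rV[R]_m) (p : 'rV[R]_m -> 'rV[R]_l) :
  V `<=` U -> smooth_map U p -> smooth_map V p.
Proof. by move=> VU ps j; exact: smooth_fun_sub VU (ps j). Qed.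

Lemma broken_cell_curve n (c : cell n) m (V : set 'rV[R]_m) p q : open V ->
  smooth_map V p -> smooth_fun V q ->
  broken V (fun x => @cell_curve n c (p x) (q x)).
Proof.
move: m V p q; have face_case r s k (c1 : cell r) (c2 : cell s) m (V : set 'rV[R]_m) p1 p2 q :
    (forall m (V : set 'rV[R]_m) p q, open V -> smooth_map V p -> smooth_fun V q ->
      broken V (fun x => @cell_curve r c1 (p x) (q x))) ->
    (forall m (V : set 'rV[R]_m) p q, open V -> smooth_map V p -> smooth_fun V q ->
      broken V (fun x => @cell_curve s c2 (p x) (q x))) ->
    open V -> smooth_map V p1 -> smooth_map V p2 -> smooth_fun V q ->
    broken V (fun x => insert k (@cell_curve s c2 (p2 x)) (@cell_curve r c1 (p1 x) (q x))).
  move=> IH1 IH2 oV p1s p2s qs; apply: (broken_insert (s := s)).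
  - by move=> x; exact: reparam_cell_curve.
  - by move=> W w oW WV ws; apply: IH2 => //; exact: smooth_map_sub p2s.
  - exact: IH1.
elim: c => [{}n n1|{}n r s k h c1 IH1 c2 IH2|{}n r s k h c1 IH1 c2 IH2] m V p q oV ps qs /=.
- exact: broken_center.
- by apply: face_case => //; [exact: smooth_lsubmx|exact: smooth_rsubmx].
- apply: (@broken_cone _ _ _ _ (fun x => rsubmx (p x) 0 0) q (fun x =>
    insert k (cell_curve (rsubmx (lsubmx (p x)))) \o cell_curve (lsubmx (lsubmx (p x))))) => //.
    exact: (smooth_rsubmx ps).
  apply: face_case => //.
    by do 2 apply: smooth_lsubmx.
  by apply: smooth_rsubmx; exact: smooth_lsubmx.
Qed.

End CellCurves.

(** * Clocks as a smooth family over the cubic complex *)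

Section FinalDiffeology.
Context {R : realType}.

#[local] Obligation Tactic := idtac.

(** Testing a final diffeology against this one gives its universal property. *)
Program Definition pullback_diff (T : Type) (Y : diffSpace R) (g : T -> Y) :
    diffeology R T :=
  @Diffeology R T (fun m U p => is_plot U (g \o p)) _ _ _ _ _.
Next Obligation. by move=> T Y g m U p; exact: plot_open. Qed.
Next Obligation. by move=> T Y g m U x; exact: (plot_cst _ (g x)). Qed.
Next Obligation.
by move=> T Y g m U p q pq; apply: plot_ext => x /pq /= ->.
Qed.
Next Obligation. by move=> T Y g m U p; exact: plot_glue. Qed.
Next Obligation. by move=> T Y g m n U V p h pU; exact: (plot_comp pU). Qed.

Lemma smooth_final (T I : Type) (A : I -> diffSpace R) (f : forall i, A i -> T)
    (Y : diffSpace R) (g : T -> Y) :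
  (forall i, @smooth R (A i) Y (g \o f i)) -> @smooth R (final_diff f) Y g.
Proof. by move=> gf m U p [_ /(_ (pullback_diff g))]; apply=> i; exact: gf. Qed.

End FinalDiffeology.

Section Curves.
Context {R : realType}.
Implicit Types n : nat.

Lemma curve_exists n (hn : (1 < n)%N) (a : cubic_space R n) :
  exists f, exists (c : cell n) (x : 'rV[R]_(cell_dim c)),
    cell_param R c x = val a /\ f = cell_curve x.
Proof.
have [c [x E]] := cells_cover hn (set_mem (valP a)).
by exists (cell_curve x), c, x.
Qed.

(** The clock of a point of |K(n)|, by choice of a cell containing it. *)
Definition curve n (hn : (1 < n)%N) (a : cubic_space R n) : R -> R :=
  projT1 (cid (curve_exists hn a)).

Lemma curveE n (hn : (1 < n)%N) (a : cubic_space R n) (c : cell n)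
    (x : 'rV[R]_(cell_dim c)) :
  cell_param R c x = val a -> curve hn a = cell_curve x.
Proof.
move=> E; rewrite /curve; case: cid => f /= [c' [x' [E' ->]]].
by apply: cell_curve_determined; rewrite E'.
Qed.

Lemma reparam_curve n (hn : (1 < n)%N) (a : cubic_space R n) :
  reparam n (curve hn a).
Proof.
have [f [c [x [E _]]]] := curve_exists hn a.
by rewrite (curveE hn E); exact: reparam_cell_curve.
Qed.

Lemma curve_face n r s k (hn : (1 < n)%N) (hr : (1 < r)%N) (hs : (1 < s)%N)
    (h : is_face n r s k) (a : cubic_space R r) (b : cubic_space R s) :
  curve hn (cubic_face h a b) = insert k (curve hs b) \o curve hr a.
Proof.
have [f [c [x [E _]]]] := curve_exists hr a.
have [g [d [y [F _]]]] := curve_exists hs b.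
have [p1 p2] := face_cellE h x y.
by rewrite (curveE hr E) (curveE hs F) -p2; apply: curveE; rewrite p1 E F.
Qed.

Lemma curve_barycenter n (hn : (1 < n)%N) (hn' : (1 < n)%N) :
  curve hn (cubic_barycenter R hn') = stall \o sweep n.
Proof. by rewrite (@curveE _ _ _ (Center hn) 0). Qed.

Lemma smooth_curve1 n (hn : (1 < n)%N) (a : cubic_space R n) :
  @smooth R (real_line R) broken_line (curve hn a).
Proof.
move=> m U q [oU qs]; have [f [c [x [E _]]]] := curve_exists hn a.
rewrite (curveE hn E); apply: (broken_cell_curve (p := fun=> x)) => //.
by move=> j; exact: smooth_fun_cst.
Qed.

Definition curve_map n (hn : (1 < n)%N) (a : cubic_space R n) :
    functional_diff (real_line R) broken_line :=
  exist _ (curve hn a) (mem_set (smooth_curve1 hn a)).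

Lemma smooth_curve n (hn : (1 < n)%N) : smooth (curve_map hn).
Proof.
apply: smooth_final => c; apply: smooth_final => _ m U p [oU ps].
split=> // l V h q VU hs [oV qs].
apply: (@plot_ext _ _ (diffeology_of broken_line) _ _
    (fun x => cell_curve (p (h x)) (q x))).
  by move=> x _ /=; rewrite (@curveE _ _ _ c (p (h x))).
apply: (broken_cell_curve (p := p \o h)) => //.
exact: (smooth_map_comp oU oV VU).
Qed.

End Curves.

(** * Concatenation of paths and the A-infinity form *)

Section PathAlgebra.
Context {R : realType} {X : diffSpace R}.
Let P := path_space X.
Implicit Types (g u v : P) (n r s k m : nat).

Lemma path_pi_set u t : path_fun u (pi_set t) = path_fun u t.
Proof. by have := set_mem (valP u) => /= /(congr1 (fun f => f t)). Qed.

Lemma path_le0 u t : t <= 0 -> path_fun u t = path_fun u 0.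
Proof.
move=> t0; rewrite -path_pi_set; congr (path_fun u _).
by rewrite /pi_set (min_idPr _) ?(max_idPl _) // (le_trans t0).
Qed.

Lemma path_ge1 u t : 1 <= t -> path_fun u t = path_fun u 1.
Proof.
move=> t1; rewrite -path_pi_set; congr (path_fun u _).
by rewrite /pi_set (min_idPl t1) (max_idPr ler01).
Qed.

Lemma path_ext u v : path_fun u =1 path_fun v -> u = v.
Proof. by move=> uv; apply/val_inj/val_inj/funext. Qed.

Definition mk_path (f : R -> X) (sf : @smooth R (real_line R) X f)
    (pf : f \o @pi_set R = f) : P :=
  exist _ (exist _ f (mem_set sf)) (mem_set pf).

Lemma path_plot m (V : set 'rV[R]_m) (p : 'rV[R]_m -> P) (q : 'rV[R]_m -> R) :
  is_plot V p -> smooth_fun V q -> is_plot V (fun x => path_fun (p x) (q x)).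
Proof.
move=> [oV pV] qs; apply: (pV m V id q) => //; exact: smooth_map_id.
Qed.

Lemma path_plotP m (U : set 'rV[R]_m) (p : 'rV[R]_m -> P) : open U ->
  (forall l (V : set 'rV[R]_l) h q, open V -> (forall x, V x -> U (h x)) ->
     smooth_map V h -> smooth_fun V q ->
     is_plot V (fun x => path_fun (p (h x)) (q x))) ->
  is_plot U p.
Proof. by move=> oU pU; split=> // l V h q VU hs [oV qs]; exact: pU. Qed.

(** The index is clipped, so that times below 0 and above size w fall in the constant
ends of the first and last path. *)
Definition concat g0 (w : seq P) (x : R) : X :=
  let i := minn (size w).-1 (Num.truncn x) in path_fun (nth g0 w i) (x - i%:R).

(** At the right end x = i + 1 the definition has moved on to the next path, whose source
is the target of the i-th by composability. *)
Lemma concat_piece g0 w i x : composable (@path_src R X) (@path_tgt R X) w ->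
  (i < size w)%N -> i%:R <= x <= i%:R + 1 ->
  concat g0 w x = path_fun (nth g0 w i) (x - i%:R).
Proof.
move=> cw iw /andP[ix xi]; rewrite /concat.
have i0 : (0 : R) <= i%:R by exact: ler0n.
case: (ltP x (i%:R + 1)) => xi1.
  have -> : Num.truncn x = i by apply: truncn_def; rewrite ix -natr1.
  by have -> : minn (size w).-1 i = i by lia.
have xE : x = i%:R + 1 by apply/eqP; rewrite eq_le xi xi1.
have -> : Num.truncn x = i.+1.
  by apply: truncn_def; rewrite xE natr1 lexx ltr_nat ltnSn.
have [iw'|iw'] := ltnP i.+1 (size w).
  have -> : minn (size w).-1 i.+1 = i.+1 by lia.
  rewrite xE -natr1 subrr [i%:R + 1]addrC addrK.
  exact/esym/cw.
by have -> : minn (size w).-1 i.+1 = i by lia.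
Qed.

Lemma concat_le0 g0 w x : x <= 0 -> concat g0 w x = path_fun (nth g0 w 0) x.
Proof.
move=> x0; rewrite /concat (_ : minn _ _ = 0%N) ?subr0 //.
rewrite (_ : Num.truncn x = 0%N) ?minn0 //; apply/truncn0Pn.
by rewrite -ltNge (le_lt_trans x0).
Qed.

Lemma concat_ge g0 w x : (size w)%:R <= x ->
  concat g0 w x = path_fun (nth g0 w (size w).-1) (x - (size w).-1%:R).
Proof.
move=> wx; rewrite /concat (_ : minn _ _ = (size w).-1) //.
apply/minn_idPl; rewrite (leq_trans (leq_pred _)) //.
by rewrite truncn_ge_nat // (le_trans _ wx).
Qed.

Lemma concat_cell n x : (0 < n)%N -> 0 <= x <= n%:R ->
  exists2 i, (i < n)%N & (i%:R : R) <= x <= i%:R + 1.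
Proof.
move=> n0 /andP[x0 xn]; have /andP[tx xt] := truncn_itv x0.
have [tn|tn] := ltnP (Num.truncn x) n.
  by exists (Num.truncn x); rewrite // tx /= natr1 ltW.
exists n.-1; first lia.
have xE : x = n%:R by apply/eqP; rewrite eq_le xn (le_trans _ tx) // ler_nat.
by rewrite xE natr1 prednK // lexx ler_nat leq_pred.
Qed.

Notation word := (word_space (@path_src R X) (@path_tgt R X)).

Lemma letter_plot m n (V : set 'rV[R]_m) (w : 'rV[R]_m -> word n)
    (g0 : 'rV[R]_m -> P) i :
  is_plot V w -> (i < n)%N -> is_plot V (fun x => nth (g0 x) (letters (w x)) i).
Proof.
move=> [oV wV] ltin; apply: plot_ext (wV (Ordinal ltin)) => x _.
exact: tnth_nth.
Qed.

(** Locally the clock f stays in one interval, so that only one letter of the word is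
evaluated; this is why clocks must be plots of the broken line. *)
Lemma concat_plot m n (V : set 'rV[R]_m) (w : 'rV[R]_m -> word n)
    (g0 : 'rV[R]_m -> P) f :
  (0 < n)%N -> is_plot V w -> broken V f ->
  is_plot V (fun x => concat (g0 x) (letters (w x)) (f x)).
Proof.
move=> n0 wV fb; have oV := plot_open wV.
have sw x : size (letters (w x)) = n by exact: size_tuple.
apply: plot_glue => // x Vx.
have [i [W [Wx oW WV Wi]]] := broken_piece fb Vx.
exists W; split=> //.
have wW := plot_sub wV oW WV.
have fW : smooth_fun W f by exact: smooth_fun_sub WV (broken_smooth fb).
suff [j jn E] : exists2 j, (j < n)%N & forall y, W y ->
    concat (g0 y) (letters (w y)) (f y) =
    path_fun (nth (g0 y) (letters (w y)) j) (f y - j%:R).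
  apply: (@plot_ext _ _ (diffeology_of X) _ _
    (fun y => path_fun (nth (g0 y) (letters (w y)) j) (f y - j%:R))).
    by move=> y Wy; rewrite E.
  apply: path_plot; first exact: letter_plot.
  by apply: smooth_funB => //; exact: smooth_fun_cst.
case: (ltP i 0) => i0.
  exists 0%N => // y /Wi /andP[_ fi]; rewrite subr0 concat_le0 //.
  apply: le_trans fi _; rewrite -[1]/(1%:~R) -rmorphD /= -[0]/(0%:~R) ler_int; lia.
case: i i0 Wi => // i _ Wi; case: (ltnP i n) => ltin.
  exists i => // y /Wi yi; apply: concat_piece => //; last by rewrite sw.
  exact: letters_composable.
exists n.-1; first lia.
move=> y /Wi /andP[iy _]; rewrite concat_ge ?sw //.
by rewrite (le_trans _ iy) // -[i%:~R]/(i%:R) ler_nat.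
Qed.

(** Concatenating with a product of paths in place k is concatenating all the letters
with the clock of that product inserted. *)
Lemma concat_insert n r s k (h : is_face n r s k) (w : seq P) (u : P) f g0 g1 g2 x :
  size w = n -> composable (@path_src R X) (@path_tgt R X) w ->
  composable (@path_src R X) (@path_tgt R X) (take k w ++ u :: drop (k + s) w) ->
  reparam s f -> (forall t, path_fun u t = concat g1 (take s (drop k w)) (f t)) ->
  0 <= x <= r%:R ->
  concat g0 w (insert k f x) = concat g2 (take k w ++ u :: drop (k + s) w) x.
Proof.
have /and4P[r1 s1 /eqP rs kr] := h.
move=> sw cw cg fr uE /(concat_cell (ltnW r1))[i ir ix].
have stk : size (take k w) = k by rewrite size_takel // sw; lia.
have sg : size (take k w ++ u :: drop (k + s) w) = r.
  by rewrite size_cat /= stk size_drop sw; lia.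
rewrite (concat_piece _ cg _ ix) ?sg // nth_cat stk.
have /andP[ix1 ix2] := ix.
case: (ltngtP i k) => ik.
- rewrite nth_take // (insert_le fr); last first.
    by rewrite (le_trans ix2) // natr1 ler_nat.
  rewrite (concat_piece _ cw _ ix) ?sw; last by lia.
  by rewrite (set_nth_default g2) // sw; lia.
- rewrite (_ : i - k = (i - k).-1.+1)%N /=; last lia.
  rewrite nth_drop (insert_ge fr); last by rewrite (le_trans _ ix1) // natr1 ler_nat.
  have E : (k + s + (i - k).-1)%:R = i%:R + s%:R - 1 :> R.
    by rewrite -natrD -natr_pred; [congr _%:R; lia|lia].
  rewrite (@concat_piece _ _ (k + s + (i - k).-1)%N) ?sw ?E //; [|lia|lra].
  rewrite (set_nth_default g2); last by rewrite sw; lia.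
  by congr (path_fun _ _); ring.
- rewrite ik subnn /= uE insert_mid -?ik // ik.
  set y := f _; have y0 : 0 <= y <= s%:R by exact: (reparam_range fr).
  have [j js jy] := concat_cell (ltnW s1) y0.
  have std : size (take s (drop k w)) = s.
    by rewrite size_takel // size_drop sw; lia.
  rewrite (concat_piece _ (composable_take_drop (k := k) (s := s) cw) _ jy) ?std //.
  rewrite (@concat_piece _ _ (k + j)%N) ?sw //; [|lia|rewrite natrD; lra].
  rewrite nth_take // nth_drop natrD (set_nth_default g1); last by rewrite sw; lia.
  by congr (path_fun _ _); ring.
Qed.

Definition form_fun n (hn : (1 < n)%N) (a : cubic_space R n) (w : word n) (t : R) : X :=
  concat (tnth (letters w) (Ordinal (ltnW hn))) (letters w) (curve hn a t).

Lemma form_fun_plot n (hn : (1 < n)%N) m (V : set 'rV[R]_m)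
    (a : 'rV[R]_m -> cubic_space R n) (w : 'rV[R]_m -> word n) q :
  is_plot V a -> is_plot V w -> smooth_fun V q ->
  is_plot V (fun x => form_fun hn (a x) (w x) (q x)).
Proof.
move=> aV wV qs; apply: concat_plot => //; first exact: ltnW.
have [oV aV'] := smooth_curve hn aV.
by apply: (aV' m V id q) => //; exact: smooth_map_id.
Qed.

Lemma form_fun_smooth n (hn : (1 < n)%N) a w : @smooth R (real_line R) X (@form_fun n hn a w).
Proof.
move=> m U q [oU qs].
by apply: (@form_fun_plot _ hn _ U (fun=> a) (fun=> w) q) => //; exact: plot_cst.
Qed.

Lemma form_fun_pi_set n (hn : (1 < n)%N) a w : @form_fun n hn a w \o @pi_set R = @form_fun n hn a w.
Proof.
apply/funext => t; rewrite /form_fun /=.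
by rewrite (reparam_pi_set _ (reparam_curve hn a)).
Qed.

Definition path_form n (hn : (1 < n)%N) (aw : prod_diff (cubic_space R n) (word n)) : P :=
  mk_path (form_fun_smooth hn aw.1 aw.2) (form_fun_pi_set hn aw.1 aw.2).

Lemma path_form_smooth n (hn : (1 < n)%N) : smooth (@path_form n hn).
Proof.
move=> m U p [p1 p2]; apply: path_plotP; first exact: plot_open p1.
move=> l V h q oV VU hs qs.
by apply: (@form_fun_plot _ hn _ V (fun x => (p (h x)).1) (fun x => (p (h x)).2) q) => //;
  [exact: (plot_comp p1)|exact: (plot_comp p2)].
Qed.

Lemma path_form_src n (hn : (1 < n)%N) a (w : word n) g0 :
  path_src (path_form hn (a, w)) = path_src (head g0 (letters w)).
Proof.
rewrite {1}/path_src /path_fun /= /form_fun (reparam_le0 (reparam_curve hn a)) //.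
rewrite concat_le0 // -nth0 /path_src; congr (path_fun _ _).
by apply: set_nth_default; rewrite size_tuple ltnW.
Qed.

Lemma path_form_tgt n (hn : (1 < n)%N) a (w : word n) g0 :
  path_tgt (path_form hn (a, w)) = path_tgt (last g0 (letters w)).
Proof.
rewrite {1}/path_tgt /path_fun /= /form_fun (reparam_ge1 (reparam_curve hn a)) //.
have sw : size (letters w) = n by exact: size_tuple.
rewrite concat_ge sw // -nth_last sw natr_pred; last lia.
rewrite opprB addrCA subrr addr0 /path_tgt; congr (path_fun _ _).
by apply: set_nth_default; rewrite sw; lia.
Qed.

(** The words v and v' stand for a subword and a graft: only their letters matter, and
leaving them abstract spares the conversion of the proofs they contain. *)
Lemma form_fun_graft n r s k (hn : (1 < n)%N) (hr : (1 < r)%N) (hs : (1 < s)%N)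
    (h : is_face n r s k) (a : cubic_space R r) (b : cubic_space R s)
    (w : word n) (v : word s) (v' : word r) u :
  letters v = take s (drop k (letters w)) :> seq P ->
  letters v' = take k (letters w) ++ u :: drop (k + s) (letters w) :> seq P ->
  path_fun u =1 form_fun hs b v ->
  form_fun hn (cubic_face h a b) w =1 form_fun hr a v'.
Proof.
move=> vE vE' uE t; rewrite /form_fun (curve_face hn hr hs) vE'.
apply: (concat_insert h); first exact: size_tuple.
- exact: letters_composable.
- by rewrite -vE'; exact: letters_composable.
- exact: reparam_curve.
- by move=> t'; rewrite uE /form_fun vE.
- exact: (reparam_range (reparam_curve hr a)).
Qed.

Lemma path_form_face n r s k (hn : (1 < n)%N) (hr : (1 < r)%N) (hs : (1 < s)%N)
    (h : is_face n r s k) (a : cubic_space R r) (b : cubic_space R s) (w : word n) :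
  path_form hn (cubic_face h a b, w) =
  path_form hr (a, graft (path_form_src hs b (subword h w)) (path_form_tgt hs b (subword h w))).
Proof.
apply: path_ext => t.
exact: (@form_fun_graft _ _ _ _ hn hr hs h a b w (subword h w) _ (path_form hs (b, subword h w))).
Qed.

(** * Homotopy units *)

Section Repath.
Variable f : R -> R.
Hypothesis f_smooth : forall m (V : set 'rV[R]_m) q, open V -> smooth_fun V q ->
  smooth_fun V (fun x => f (q x)).
Hypothesis f_le0 : forall t : R, t <= 0 -> f t <= 0.
Hypothesis f_ge1 : forall t : R, 1 <= t -> 1 <= f t.

(** The linear homotopy from f to the identity; step makes it take values between the
two for all real c. *)
Definition blend (c t : R) : R := (1 - step c) * f t + step c * t.

Lemma blend_smooth m (V : set 'rV[R]_m) p q : open V -> smooth_fun V p ->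
  smooth_fun V q -> smooth_fun V (fun x => blend (p x) (q x)).
Proof.
move=> oV ps qs; have ss := smooth_fun_step oV ps.
apply: smooth_funD => //; apply: smooth_funM => //; last exact: f_smooth.
by apply: smooth_funB => //; exact: smooth_fun_cst.
Qed.

Definition repath_fun (c : R) g t := path_fun g (blend c t).

Lemma repath_smooth (c : R) g : @smooth R (real_line R) X (repath_fun c g).
Proof.
move=> m U q [oU qs]; apply: (path_plot (p := fun=> g)); first exact: plot_cst.
by apply: (blend_smooth (p := fun=> c)) => //; exact: smooth_fun_cst.
Qed.

Lemma blend_le0 (c t : R) : t <= 0 -> blend c t <= 0.
Proof.
move=> t0; have := f_le0 t0; have := step_ge0 c; have := step_le1 c.
by rewrite /blend; set d := step c; nra.
Qed.

Lemma blend_ge1 (c t : R) : 1 <= t -> 1 <= blend c t.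
Proof.
move=> t0; have := f_ge1 t0; have := step_ge0 c; have := step_le1 c.
by rewrite /blend; set d := step c; nra.
Qed.

Lemma repath_pi_set (c : R) g : repath_fun c g \o @pi_set R = repath_fun c g.
Proof.
apply/funext => t; rewrite /= /repath_fun.
case: (leP t 0) => t0.
  rewrite path_le0 ?[RHS]path_le0 ?blend_le0 //.
  by rewrite /pi_set (min_idPr _) ?(max_idPl _) // (le_trans t0).
case: (leP 1 t) => t1; last by rewrite pi_set_id // !ltW.
rewrite path_ge1 ?[RHS]path_ge1 ?blend_ge1 //.
by rewrite /pi_set (min_idPl t1) (max_idPr ler01).
Qed.

Definition repath (sg : prod_diff (real_line R) (path_space X)) : P :=
  mk_path (repath_smooth sg.1 sg.2) (repath_pi_set sg.1 sg.2).

(** The path g absorbs times outside [0, 1], so a clock need only send t <= 0 to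
nonpositive and t >= 1 to times at least 1, a condition kept by convex
combinations. *)
Lemma homotopic_id (F : P -> P) :
  (forall g t, path_fun (F g) t = path_fun g (f t)) ->
  smoothly_homotopic F (fun g => g).
Proof.
move=> FE; exists repath; split.
- move=> m U p [[oU p1] p2]; apply: path_plotP => // l V h q oV VU hs qs.
  apply: (@path_plot _ V (fun x => (p (h x)).2) (fun x => blend (p (h x)).1 (q x))).
    exact: (plot_comp p2).
  apply: blend_smooth => //.
  exact: (smooth_fun_comp oU oV VU hs p1).
- move=> g; apply: path_ext => t; rewrite FE /path_fun /=.
  rewrite /repath_fun /blend step_eq0; last by lra.
  by rewrite subr0 mul1r mul0r addr0.
- move=> g; apply: path_ext => t; rewrite /path_fun /=.
  rewrite /repath_fun /blend step_eq1; last by lra.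
  by rewrite subrr mul0r mul1r add0r.
Qed.

End Repath.

Lemma paths_precategory : is_precategory (@path_src R X) (@path_tgt R X) (@path_const R X).
Proof.
split=> //.
- by move=> m U p pU; apply: path_plot => //; exact: smooth_fun_cst.
- by move=> m U p pU; apply: path_plot => //; exact: smooth_fun_cst.
- move=> m U p pU; apply: path_plotP => [|l V h q oV VU hs qs]; first exact: plot_open pU.
  exact: (plot_comp pU oV VU hs).
Qed.

Let C := paths_precategory.

Lemma center_smooth n m (V : set 'rV[R]_m) q : open V -> smooth_fun V q ->
  smooth_fun V (fun x => stall (sweep n (q x))).
Proof. by move=> oV qs; apply: broken_smooth; exact: broken_center. Qed.

(** The clock y of the product acts on g as y - 1: times y <= 1 are spent on the
constant path, where y - 1 <= 0 gives the same value g 0. *)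
Lemma path_form_left_unit : smoothly_homotopic
  (fun g => @path_form 2%N isT (cubic_barycenter R (isT : (1 < 2)%N), left_unit_word C g))
  (fun g => g).
Proof.
have br : reparam 2 (stall \o sweep 2 : R -> R).
  by rewrite -(curve_barycenter (isT : (1 < 2)%N) isT); exact: reparam_curve.
apply: (@homotopic_id (fun t => stall (sweep 2 t) - 1)).
- move=> m V q oV qs; apply: smooth_funB => //; last exact: smooth_fun_cst.
  exact: center_smooth.
- by move=> t /(reparam_le0 br) /= ->; lra.
- by move=> t /(reparam_ge1 br) /= ->; lra.
move=> g t; rewrite {1}/path_fun /= /form_fun curve_barycenter /=.
have := reparam_range br t => /=; move: (stall _) => y /andP[y0 y1].
have cw : composable (@path_src R X) (@path_tgt R X) [:: path_const (path_src g); g].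
  exact: (@composable_left_unit _ _ _ _ _ _ C g).
case: (leP y 1) => y2.
  rewrite (@concat_piece _ _ 0 _ cw) //=; last by rewrite y0 add0r.
  by rewrite [RHS]path_le0 //; lra.
by rewrite (@concat_piece _ _ 1 _ cw) //=; lra.
Qed.

Lemma path_form_right_unit : smoothly_homotopic
  (fun g => @path_form 2%N isT (cubic_barycenter R (isT : (1 < 2)%N), right_unit_word C g))
  (fun g => g).
Proof.
have br : reparam 2 (stall \o sweep 2 : R -> R).
  by rewrite -(curve_barycenter (isT : (1 < 2)%N) isT); exact: reparam_curve.
apply: (@homotopic_id (fun t => stall (sweep 2 t))).
- by move=> m V q oV qs; exact: center_smooth.
- by move=> t /(reparam_le0 br) /= ->; lra.
- by move=> t /(reparam_ge1 br) /= ->; lra.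
move=> g t; rewrite {1}/path_fun /= /form_fun curve_barycenter /=.
have := reparam_range br t => /=; move: (stall _) => y /andP[y0 y1].
have cw : composable (@path_src R X) (@path_tgt R X) [:: g; path_const (path_tgt g)].
  exact: (@composable_right_unit _ _ _ _ _ _ C g).
case: (leP y 1) => y2.
  by rewrite (@concat_piece _ _ 0 _ cw) //= ?subr0 // y0 add0r.
rewrite (@concat_piece _ _ 1 _ cw) //=; last by lra.
by rewrite [RHS]path_ge1 //; lra.
Qed.

End PathAlgebra.

Theorem theoremA1 (R : realType) (X : diffSpace R) :
  is_hunital_Ainfty_category
    (@path_src R X) (@path_tgt R X) (@path_const R X).
Proof.
exists paths_precategory, path_form.
apply: (IsHunitalAinftyForm path_form_smooth path_form_face path_form_left_unit path_form_right_unit).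
Qed.
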